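(* Let $n,d$ be positive integers with $n\geq d(d+2)$. Then $g(n,d)=n+d-2$.
   Context: All graphs are finite and simple. A graph $G$ is $d$-rigid if some (equivalently every) generic $d$-dimensional bar-and-joint framework $(G,p)$ (with $p:V(G)\to\mathbb{R}^d$ having coordinates algebraically independent over $\mathbb{Q}$) is rigid, i.e. admits no continuous edge-length-preserving motion that changes some pairwise distance between vertices. For a graph $G=(V,E)$, $\eta(G)=\min_{uv\notin E,\,u\neq v}(\deg_G(u)+\deg_G(v))$ (taken as $+\infty$ if $G$ is complete). For $n,d\in\mathbb{N}$, $g(n,d)$ is the smallest integer such that every $n$-vertex graph $G$ with $\eta(G)\geq g(n,d)$ is $d$-rigid. *)

(* Defs.v *)
(* the real numbers are an arbitrary [realType] (all are
   isomorphic complete archimedean ordered fields). *)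
From HB Require Import structures.
From mathcomp Require Import all_boot all_order all_algebra.
From mathcomp Require Import reals.
From mathcomp Require Import mpoly.
Set Implicit Arguments. Unset Strict Implicit. Unset Printing Implicit Defensive.
Import Order.TTheory GRing.Theory Num.Theory.
Local Open Scope ring_scope.

Definition simple_graph (n : nat) (e : rel 'I_n) : Prop :=
  ssrbool.symmetric e /\ irreflexive e.

Definition deg (n : nat) (e : rel 'I_n) (u : 'I_n) : nat := #|[set v | e u v]|.

(* eta(G) >= k, i.e. min_{uv notin E, u <> v} (deg u + deg v) >= k,
   with the convention eta(G) = +oo for complete G. *)
Definition eta_ge (n : nat) (e : rel 'I_n) (k : int) : Prop :=
  forall u v : 'I_n, u != v -> ~~ e u v -> k <= ((deg e u + deg e v)%N)%:Z.

Definition alg_indep (R : realType) (I : finType) (x : I -> R) : Prop :=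
  forall P : {mpoly rat[#|{: I}|]},
    (map_mpoly (ratr : rat -> R) P).@[fun k => x (enum_val k)] = 0 -> P = 0.

Definition generic (R : realType) (n d : nat) (p : 'I_n -> 'I_d -> R) : Prop :=
  alg_indep (fun vi : 'I_n * 'I_d => p vi.1 vi.2).

Definition sqdist (R : realType) (d : nat) (a b : 'I_d -> R) : R :=
  \sum_(i < d) (a i - b i) ^+ 2.

Definition in01 (R : realType) (t : R) : bool := (0 <= t) && (t <= 1).

Definition continuous_motion (R : realType) (n d : nat) (e : rel 'I_n)
    (p : 'I_n -> 'I_d -> R) (x : R -> 'I_n -> 'I_d -> R) : Prop :=
  [/\ x 0 = p,
      (forall t, in01 t -> forall eps : R, 0 < eps -> exists2 delta : R, 0 < delta &
         forall s, in01 s -> `|s - t| < delta ->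
           forall v i, `|x s v i - x t v i| < eps) &
      (forall t, in01 t -> forall u v, e u v ->
         sqdist (x t u) (x t v) = sqdist (p u) (p v))].

Definition rigid_framework (R : realType) (n d : nat) (e : rel 'I_n)
    (p : 'I_n -> 'I_d -> R) : Prop :=
  forall x, continuous_motion e p x ->
    forall t, in01 t -> forall u v, sqdist (x t u) (x t v) = sqdist (p u) (p v).

Definition d_rigid (R : realType) (n d : nat) (e : rel 'I_n) : Prop :=
  exists p : 'I_n -> 'I_d -> R, generic p /\ rigid_framework e p.

Definition g_bound (R : realType) (n d : nat) (k : int) : Prop :=
  forall e : rel 'I_n, simple_graph e -> eta_ge e k -> d_rigid R d e.

Definition g_is (R : realType) (n d : nat) (k : int) : Prop :=
  g_bound R n d k /\ forall k' : int, g_bound R n d k' -> k <= k'.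

(* Main.v *)
(* The lower bound comes from a clique on [n - 1] vertices plus a vertex of degree
   [d - 1], which moves along a circle.

   For the upper bound, let [e] be closed in the generic [d]-dimensional rigidity
   matroid and not complete. The degree condition gives every two nonadjacent vertices
   [d] common neighbours, so, as a clique absorbs every vertex with [d] neighbours in
   it, no neighbourhood is a clique, and all degrees exceed [d]. Add the vertices in a
   uniformly random order. A vertex arriving with [k] earlier neighbours raises the rank
   by at least [min(d, k)] (0-extension), and by [d + 1] if [k > d] and these neighbours
   are not a clique (1-extension). The expected gain of a vertex of degree [D] is at
   least [d + 1/2 - d(d+1)/(2D)], whereas the rank is at most [dn - d(d+1)/2]. Hence
   [n <= d(d+1) (sum 1/D - 1)], while the degree condition gives
   [sum 1/D < 2 + 1/(d+1)] for [d > 1], so that [n < d(d+2)].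

   Finally, if [p] and [q] have the same edge lengths then [p - q] is an infinitesimal
   motion of [(p + q)/2], which turns infinitesimal rigidity into rigidity without any
   differentiability assumption on motions. *)
Require Import Defs.
From HB Require Import structures.
From mathcomp Require Import all_boot all_order all_algebra.
From mathcomp Require Import reals mpoly.
From mathcomp Require Import ring lra zify.
Set Implicit Arguments. Unset Strict Implicit. Unset Printing Implicit Defensive.
Import Order.TTheory GRing.Theory Num.Theory.
Local Open Scope ring_scope.

(** * Algebraically independent points *)

(** Cantor's nested intervals: the interval chosen at step [k] excludes [f k], and the supremum of
    the left ends lies in all of them. *)
Lemma real_avoid_sequence (R : realType) (f : nat -> R) :
  exists x, forall k, x != f k.
Proof.
pose step (ab : R * R) y := let m := (ab.1 + ab.2) / 2 in
  (* The left end moves strictly beyond [m] because [y] may equal [m]; otherwise [y > m] lies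
     outside already. *)
  if y <= m then ((m + ab.2) / 2, ab.2) else (ab.1, m).
pose I := fix I k := if k is k'.+1 then step (I k') (f k') else (0, 1).
have Ilt k : (I k).1 < (I k).2.
  by elim: k => [|k IH] /=; rewrite ?ltr01 // /step; case: ifP => /= _; lra.
have Isub k : (I k).1 <= (I k.+1).1 /\ (I k.+1).2 <= (I k).2.
  by have := Ilt k; rewrite /= /step; case: ifP => /= _; lra.
have Imono k l : (I k).1 <= (I (k + l)%N).1 /\ (I (k + l)%N).2 <= (I k).2.
  elim: l => [|l [IH1 IH2]]; first by rewrite addn0.
  have [H1 H2] := Isub (k + l)%N.
  by rewrite addnS; split; [exact: le_trans H1|exact: le_trans IH2].
have Icross k l : (I k).1 <= (I l).2.
  have [H1 _] := Imono k l; have [_ H2] := Imono l k.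
  rewrite addnC in H2.
  exact: le_trans H1 (le_trans (ltW (Ilt _)) H2).
pose A := fun x : R => exists k, x = (I k).1.
have Asup : classical_sets.has_sup A.
  split; first by exists (I 0%N).1, 0%N.
  by exists (I 0%N).2 => _ [k ->]; exact: Icross.
exists (sup A) => k; apply/negP => /eqP supE.
have lo : (I k.+1).1 <= f k.
  by rewrite -supE; apply: sup_upper_bound => //; exists k.+1.
have hi : f k <= (I k.+1).2.
  rewrite -supE; apply: sup_le_ub; first by exists (I 0%N).1, 0%N.
  by move=> _ [l ->]; exact: Icross.
have := Ilt k; move: lo hi; rewrite /= /step; case: (leP (f k)) => /=; lra.
Qed.

Lemma poly_root_seq (R : fieldType) (q : {poly R}) : q != 0 ->
  exists s : seq R, forall x, root q x -> x \in s.
Proof.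
have [m] := ubnP (size q); elim: m q => // m IH q sq q0.
have [[x rx]|nr] := boolp.EM (exists x, root q x); last first.
  by exists [::] => x rx; case: nr; exists x.
have /factor_theorem[q' qE] := rx.
have q'0 : q' != 0 by apply: contraNneq q0 => q'0; rewrite qE q'0 mul0r.
have [|s sP] := IH q' _ q'0.
  by move: sq; rewrite qE size_Mmonic ?monicXsubC // size_XsubC addn2.
exists (x :: s) => y; rewrite qE rootM inE => /orP[/sP->|]; rewrite ?orbT //.
by rewrite root_XsubC => ->.
Qed.

Lemma avoid_countable_roots (R : realType) (q : nat -> {poly R}) :
  exists x, forall k, q k != 0 -> (q k).[x] != 0.
Proof.
have /boolp.choice[s sP] k : exists s : seq R,
    forall x, q k != 0 -> root (q k) x -> x \in s.
  have [->|q0] := eqVneq (q k) 0; first by exists [::] => x /eqP.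
  by have [s sP] := poly_root_seq q0; exists s => x _; exact: sP.
(* One sequence lists every root of every nonzero [q k], indexed by the codes of the pairs
   (polynomial, position in its root list); 0 fills the remaining indices. *)
pose f i := if unpickle i is Some kj then nth 0 (s kj.1) kj.2 else 0 : R.
have [x xP] := real_avoid_sequence f; exists x => k q0.
apply/negP => qx; have xs : x \in s k by apply: sP.
have := xP (pickle (k, index x (s k))).
by rewrite /f pickleK /= nth_index ?eqxx.
Qed.

(** The code lives in a countable type, so [pickle] enumerates the rational polynomials. *)
Definition mpoly_code (n : nat) (P : {mpoly rat[n]}) : seq ('X_{1..n} * rat) :=
  [seq (m, P@_m) | m <- msupp P].

Lemma mpoly_code_inj n : injective (@mpoly_code n).
Proof.
move=> P Q PQ; rewrite (mpolyE P) (mpolyE Q).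
have E (P' : {mpoly rat[n]}) :
    \sum_(m <- msupp P') P'@_m *: 'X_[m] = \sum_(mc <- mpoly_code P') mc.2 *: 'X_[mc.1].
  by rewrite [RHS]big_map.
by rewrite !E PQ.
Qed.

Definition qeval (R : realType) (n : nat) (x : 'I_n -> R) (P : {mpoly rat[n]}) : R :=
  (map_mpoly (ratr : rat -> R) P).@[x].

HB.instance Definition _ (R : realType) (n : nat) (x : 'I_n -> R) :=
  GRing.RMorphism.copy (qeval x) (meval x \o map_mpoly (ratr : rat -> R)).

Lemma qevalZ (R : realType) n (x : 'I_n -> R) c (P : {mpoly rat[n]}) :
  qeval x (c *: P) = ratr c * qeval x P.
Proof. by rewrite /qeval map_mpolyZ mevalZ. Qed.

Lemma qevalX (R : realType) n (x : 'I_n -> R) (m : 'X_{1..n}) :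
  qeval x 'X_[m] = \prod_i x i ^+ m i.
Proof. by rewrite /qeval map_mpolyX mevalX. Qed.

Lemma qevalXU (R : realType) n (x : 'I_n -> R) (i : 'I_n) :
  qeval x 'X_i = x i.
Proof. by rewrite /qeval map_mpolyX mevalXU. Qed.

Local Notation widen := (widen_ord (leqnSn _)).

(** The left inverse [psi] widens the coefficients and substitutes the last variable. *)
Lemma muni_inj n : injective (@muni n rat).
Proof.
pose psi (q : {poly {mpoly rat[n]}}) := (mpwiden q).['X_ord_max].
suff muniK : cancel (@muni n rat) psi by exact: can_inj muniK.
move=> p; rewrite muniE /psi raddf_sum /= horner_sum [RHS]mpolyE.
apply: eq_bigr => m _; rewrite mpwidenZ hornerZ rmorphXn /= mpwidenX hornerXn.
rewrite mwidenZ mwidenX -scalerAl mpolyXn -mpolyXD; congr (_ *: 'X_[_]).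
apply/mnmP => i; rewrite mnmDE mulmnE mnm1E.
case: (unliftP ord_max i) => [j ->|->]; last first.
  by rewrite eqxx mul1n mnmwiden_ordmax.
rewrite (negbTE (neq_lift _ _)) mul0n addn0.
have -> : lift ord_max j = widen j by apply/ord_inj; rewrite lift_max.
by rewrite mnmwiden_widen mnmE.
Qed.

Lemma qeval_muni (R : realType) n (x : 'I_n.+1 -> R) (P : {mpoly rat[n.+1]}) :
  qeval x P = (map_poly (qeval (fun i : 'I_n => x (widen i))) (muni P)).[x ord_max].
Proof.
rewrite muniE {1}[P]mpolyE !rmorph_sum /= horner_sum.
apply: eq_bigr => m _; rewrite map_polyZ /= map_polyXn hornerZ hornerXn.
rewrite !qevalZ !qevalX big_ord_recr /= mulrA; congr (_ * _ * _).
by apply: eq_bigr => i _; rewrite mnmE.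
Qed.

(** Induction on the number of coordinates. By independence of the earlier ones, a nonzero [P]
    specialises to a nonzero univariate polynomial, and the last coordinate avoids the roots of
    these countably many polynomials. *)
Lemma alg_indep_point (R : realType) (n : nat) :
  exists x : 'I_n -> R, forall P : {mpoly rat[n]}, qeval x P = 0 -> P = 0.
Proof.
elim: n => [|n [x xP]].
  exists (fun=> 0) => P; rewrite (nvar0_mpolyC P) /qeval map_mpolyC mevalC.
  by move=> /eqP; rewrite fmorph_eq0 => /eqP->; rewrite mpolyC0.
have /boolp.choice[q qP] k : exists q : {poly R}, forall P : {mpoly rat[n.+1]},
    pickle (mpoly_code P) = k -> q = map_poly (qeval x) (muni P).
  have [[P Pk]|nP] := boolp.EM (exists P : {mpoly rat[n.+1]}, pickle (mpoly_code P) = k).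
    exists (map_poly (qeval x) (muni P)) => Q; rewrite -Pk => /(pcan_inj pickleK).
    by move=> /mpoly_code_inj->.
  by exists 0 => P Pk; case: nP; exists P.
have [t tP] := avoid_countable_roots q.
pose y (i : 'I_n.+1) := if unlift ord_max i is Some j then x j else t.
have yt : y ord_max = t by rewrite /y unlift_none.
have yx : (fun i : 'I_n => y (widen i)) =1 x.
  move=> i; rewrite /y (_ : widen i = lift ord_max i) ?liftK //.
  by apply/ord_inj; rewrite lift_max.
exists y => P /eqP; rewrite qeval_muni yt.
have -> : map_poly (qeval (fun i : 'I_n => y (widen i))) (muni P)
    = map_poly (qeval x) (muni P).
  by apply: eq_map_poly => Q; apply: meval_eq.
rewrite -(qP _ _ erefl); apply: contraTeq => P0; apply: tP.
rewrite (qP _ _ erefl); apply/eqP => q0; case/eqP: P0.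
apply: muni_inj; rewrite rmorph0; apply/polyP => i; rewrite coef0.
by apply: xP; rewrite -coef_map q0 coef0.
Qed.

(** * The rigidity matrix at a generic placement *)

Lemma subset_of_card (I : finType) (A : {set I}) k :
  (k <= #|A|)%N -> exists2 B : {set I}, B \subset A & #|B| = k.
Proof.
move=> kA; exists [set t in take k (enum A)].
  by apply/subsetP => t; rewrite inE => /mem_take; rewrite mem_enum.
rewrite cardsE; have /card_uniqP-> : uniq (take k (enum A)).
  by rewrite take_uniq ?enum_uniq.
by rewrite size_takel // -cardE.
Qed.

Section RigidityMatrix.
Variables (R : realType) (n d : nat).
Implicit Types (p q : 'I_n -> 'I_d -> R) (F : {set 'I_n * 'I_n}).
Local Notation N := #|{: 'I_n * 'I_d}|.
Local Notation E := #|{: 'I_n * 'I_n}|.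

Definition coords p (k : 'I_N) : R := p (enum_val k).1 (enum_val k).2.

Definition coordX (v : 'I_n) (i : 'I_d) : {mpoly rat[N]} := 'X_(enum_rank (v, i)).

Lemma qeval_coordX p v i : qeval (coords p) (coordX v i) = p v i.
Proof. by rewrite qevalXU /coords enum_rankK. Qed.

(** A nonvanishing minor of maximal size at [q] is the value of a nonzero rational polynomial, which
    cannot vanish at the algebraically independent coordinates of [p]. *)
Lemma generic_rank a b (M : 'M[{mpoly rat[N]}]_(a, b)) p q : generic p ->
  (\rank (map_mx (qeval (coords q)) M) <= \rank (map_mx (qeval (coords p)) M))%N.
Proof.
move=> gp; set A := map_mx (qeval (coords q)) M.
pose f := maxrankfun A; pose B := rowsub f A.
have Bfree : row_free B by exact: maxrowsub_free.
have BTfull : row_full B^T by rewrite /row_full mxrank_tr; exact: Bfree.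
pose g := fullrankfun BTfull.
have Cunit : (rowsub g B^T)^T \in unitmx by rewrite unitmx_tr fullrowsub_unit.
have CE q' : map_mx (qeval (coords q')) (mxsub f g M)
    = (rowsub g (rowsub f (map_mx (qeval (coords q')) M))^T)^T.
  by apply/matrixP => i j; rewrite !mxE.
have detM : \det (mxsub f g M) != 0.
  apply: contraTneq Cunit => D0; rewrite -CE unitmxE det_map_mx D0 rmorph0.
  by rewrite unitr0.
have detp : \det (map_mx (qeval (coords p)) (mxsub f g M)) != 0.
  by rewrite det_map_mx; apply: contra_neq detM => /gp.
have Up : map_mx (qeval (coords p)) (mxsub f g M) \in unitmx by rewrite unitmxE unitfE.
rewrite -[leqLHS](mxrank_unit Up) CE mxrank_tr.
apply: leq_trans (mxrankS (rowsub_sub _ _)) _.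
by rewrite mxrank_tr mxrankS ?rowsub_sub.
Qed.

(** The row of the rigidity matrix for the pair [uv]: [p u - p v] in the block of [u], its negative
    in the block of [v], zero elsewhere. *)
Definition rho p (uv : 'I_n * 'I_n) : 'rV[R]_N :=
  \row_j ((((enum_val j).1 == uv.1)%:R - ((enum_val j).1 == uv.2)%:R)
          * (p uv.1 (enum_val j).2 - p uv.2 (enum_val j).2)).

(** Pairs outside [F] keep a zero row, so that the matrices for all [F] have the same shape. *)
Definition Rig p F : 'M[R]_(E, N) :=
  \matrix_(k < E) (if enum_val k \in F then rho p (enum_val k) else 0).

Lemma rhoC p u v : rho p (u, v) = rho p (v, u).
Proof. by apply/rowP => j; rewrite !mxE /=; ring. Qed.

Lemma rhoxx p u : rho p (u, u) = 0.
Proof. by apply/rowP => j; rewrite !mxE /= subrr mul0r. Qed.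

Lemma rho_sub p F uv : uv \in F -> (rho p uv <= Rig p F)%MS.
Proof.
move=> uvF; have -> : rho p uv = row (enum_rank uv) (Rig p F).
  by rewrite rowK enum_rankK uvF.
exact: row_sub.
Qed.

Lemma Rig_subP p F m (B : 'M[R]_(m, N)) :
  reflect (forall uv, uv \in F -> (rho p uv <= B)%MS) (Rig p F <= B)%MS.
Proof.
apply: (iffP row_subP) => H uv; first by move=> /(rho_sub p)/submx_trans; apply; apply/row_subP.
by rewrite rowK; case: ifP => [/H//|_]; exact: sub0mx.
Qed.

Lemma RigS p F F' : F \subset F' -> (Rig p F <= Rig p F')%MS.
Proof. by move=> /subsetP sF; apply/Rig_subP => uv /sF; exact: rho_sub. Qed.

Lemma generic_rank_Rig p q F : generic p ->
  (\rank (Rig q F) <= \rank (Rig p F))%N.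
Proof.
pose M := \matrix_(k < E, j < N) (if enum_val k \in F then
    (((enum_val j).1 == (enum_val k).1)%:R - ((enum_val j).1 == (enum_val k).2)%:R)
    * (coordX (enum_val k).1 (enum_val j).2 - coordX (enum_val k).2 (enum_val j).2)
  else 0).
have ME q' : map_mx (qeval (coords q')) M = Rig q' F.
  apply/matrixP => k j; rewrite !mxE; case: ifP => _; last by rewrite rmorph0 mxE.
  by rewrite !mxE rmorphM !rmorphB /= !rmorph_nat !qeval_coordX.
by move=> gp; rewrite -!ME; exact: generic_rank.
Qed.

Definition dirs p v (T : {set 'I_n}) : 'M[R]_(n, d) :=
  \matrix_(t < n) (if t \in T then \row_i (p v i - p t i) else 0).

Lemma dir_sub p v (T : {set 'I_n}) t : t \in T ->
  (\row_i (p v i - p t i) <= dirs p v T)%MS.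
Proof.
move=> tT; have -> : \row_i (p v i - p t i) = row t (dirs p v T) by rewrite rowK tT.
exact: row_sub.
Qed.

Lemma dirs_subP p v (T : {set 'I_n}) m (B : 'M[R]_(m, d)) :
  reflect (forall t, t \in T -> (\row_i (p v i - p t i) <= B)%MS) (dirs p v T <= B)%MS.
Proof.
apply: (iffP row_subP) => H t; first by move=> /(dir_sub p v)/submx_trans; apply; apply/row_subP.
by rewrite rowK; case: ifP => [/H//|_]; exact: sub0mx.
Qed.

Lemma generic_dirs p v (T : {set 'I_n}) : generic p -> v \notin T ->
  (#|T| <= d)%N -> \rank (dirs p v T) = #|T|.
Proof.
move=> gp vT Td.
pose M := \matrix_(t < n, i < d) (if t \in T then coordX v i - coordX t i else 0).
have ME q' : map_mx (qeval (coords q')) M = dirs q' v T.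
  apply/matrixP => t i; rewrite !mxE; case: ifP => _; last by rewrite rmorph0 mxE.
  by rewrite !mxE rmorphB /= !qeval_coordX.
apply/eqP; rewrite eqn_leq; apply/andP; split.
  pose D := \matrix_(k < #|T|) (\row_i (p v i - p (enum_val k) i)).
  apply: leq_trans (rank_leq_row D); apply/mxrankS/dirs_subP => t tT.
  have -> : \row_i (p v i - p t i) = row (enum_rank_in tT t) D.
    by rewrite rowK enum_rankK_in.
  exact: row_sub.
(* By [generic_rank] one good placement suffices: [v] sits at the origin and the members of [T] at
   distinct negated unit vectors. *)
pose q (t : 'I_n) (i : 'I_d) : R := if t \in T then (- (index t (enum T) == i)%:R) else 0.
rewrite -(ME p); apply: leq_trans (generic_rank M q gp); rewrite ME.
pose D : 'M[R]_(#|T|, d) := pid_mx #|T|.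
have <- : \rank D = #|T| by rewrite rank_pid_mx.
apply/mxrankS/row_subP => k.
have kT : enum_val k \in T by exact: enum_valP.
have -> : row k D = \row_i (q v i - q (enum_val k) i); last exact: dir_sub.
apply/rowP => i; rewrite !mxE /q (negbTE vT) kT sub0r opprK.
by rewrite /enum_val index_uniq ?enum_uniq -?cardE // ltn_ord andbT.
Qed.

Definition proj v : 'M[R]_(N, d) := \matrix_(j, i) (enum_val j == (v, i))%:R.

Lemma projE v (x : 'rV[R]_N) : x *m proj v = \row_i x 0 (enum_rank (v, i)).
Proof.
apply/rowP => i; rewrite !mxE (bigD1 (enum_rank (v, i))) //= mxE enum_rankK eqxx mulr1.
rewrite big1 ?addr0 // => j ji; rewrite mxE [_ == _]negbTE ?mulr0 //.
by apply: contraNneq ji => <-; rewrite enum_valK.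
Qed.

Lemma rho_proj p v u w :
  rho p (u, w) *m proj v = ((v == u)%:R - (v == w)%:R) *: \row_i (p u i - p w i).
Proof. by rewrite projE; apply/rowP => i; rewrite !mxE enum_rankK. Qed.

(** Rank-nullity for the projection to the block of [v]: the image of the row space contains the
    directions from [v] to [T], and the kernel contains the rows of [B]. *)
Lemma rank_extend p F v (T : {set 'I_n}) m (B : 'M[R]_(m, N)) :
  v \notin T -> (forall t, t \in T -> (v, t) \in F) ->
  (B <= Rig p F)%MS -> B *m proj v = 0 ->
  (\rank B + \rank (dirs p v T) <= \rank (Rig p F))%N.
Proof.
move=> vT TF BF B0; rewrite -(mxrank_mul_ker (Rig p F) (proj v)) addnC leq_add //.
  apply/mxrankS/dirs_subP => t tT.
  have -> : \row_i (p v i - p t i) = rho p (v, t) *m proj v.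
    rewrite rho_proj eqxx [_ == t]negbTE ?subr0 ?scale1r //.
    by apply: contraNneq vT => ->.
  by rewrite submxMr // rho_sub // TF.
by apply/mxrankS; rewrite sub_capmx BF; apply/sub_kermxP.
Qed.

Definition avoids v F := forall u w, (u, w) \in F -> (u != v) && (w != v).

Lemma Rig_proj0 p v F : avoids v F -> Rig p F *m proj v = 0.
Proof.
move=> vF; apply/sub_kermxP/Rig_subP => -[u w] /vF/andP[uv wv].
apply/sub_kermxP; rewrite rho_proj eq_sym (negbTE uv) eq_sym (negbTE wv).
by rewrite subrr scale0r.
Qed.

Lemma rank_0ext p F F' v (T : {set 'I_n}) : generic p -> avoids v F -> F \subset F' ->
  v \notin T -> (forall t, t \in T -> (v, t) \in F') ->
  (\rank (Rig p F) + minn d #|T| <= \rank (Rig p F'))%N.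
Proof.
move=> gp vF FF' vT TF'.
have [T' T'T T'E] := subset_of_card (geq_minr d #|T|).
have vT' : v \notin T' by apply: contra vT => /(subsetP T'T).
rewrite -T'E -(generic_dirs gp vT') ?T'E ?geq_minl //; apply: rank_extend => //.
- by move=> t /(subsetP T'T)/TF'.
- exact: RigS.
- exact: Rig_proj0.
Qed.

Definition move_to p v (a : 'I_d -> R) : 'I_n -> 'I_d -> R :=
  fun u => if u == v then a else p u.

Lemma Rig_move_to p v a F : avoids v F -> Rig (move_to p v a) F = Rig p F.
Proof.
move=> vF; apply/matrixP => k j; rewrite !mxE; case: ifP => // kF.
have /andP[/negbTE u1 /negbTE u2] : ((enum_val k).1 != v) && ((enum_val k).2 != v).
  by apply: vF; case: (enum_val k) kF.
by rewrite !mxE /move_to u1 u2.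
Qed.

(* Moving [v] to the midpoint of [x] and [y] makes the edges [vx] and [vy]
   generate the absent edge [xy], while the other edges at [v] still contribute [d]. *)
Lemma rank_1ext p F F' v (T : {set 'I_n}) x y : generic p -> avoids v F ->
  F \subset F' -> v \notin T -> (forall t, t \in T -> (v, t) \in F') ->
  x \in T -> y \in T -> #|T| = d.+1 -> ~~ (rho p (x, y) <= Rig p F)%MS ->
  (\rank (Rig p F) + d.+1 <= \rank (Rig p F'))%N.
Proof.
move=> gp vF FF' vT TF' xT yT cT xyF.
pose a i := (p x i + p y i) / 2; pose q := move_to p v a.
have vx : (x == v) = false by apply/negbTE; apply: contraNneq vT => <-.
have vy : (y == v) = false by apply/negbTE; apply: contraNneq vT => <-.
have qx : q x = p x by rewrite /q /move_to vx.
have qv : q v = a by rewrite /q /move_to eqxx.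
have qy : q y = p y by rewrite /q /move_to vy.
apply: leq_trans (generic_rank_Rig q F' gp).
pose B := col_mx (Rig q F) (rho q (x, y)).
have rB : (\rank (Rig p F) < \rank B)%N.
  rewrite -(Rig_move_to p a vF) -/q.
  have sB : (Rig q F <= B)%MS by rewrite -addsmxE addsmxSl.
  rewrite (ltn_leqif (mxrank_leqif_sup sB)); apply: contra xyF.
  rewrite -(Rig_move_to p a vF) -/q; apply: submx_trans.
  have -> : rho p (x, y) = rho q (x, y) by apply/rowP => j; rewrite !mxE /= qx qy.
  by rewrite -addsmxE addsmxSr.
(* The directions from the midpoint span those from [x] to the other [d] members of [T], which are
   independent at the generic [p]. *)
have rd : (d <= \rank (dirs q v T))%N.
  have cTx : #|T :\ x| = d by apply/eqP; rewrite -eqSS -cT [eqbRHS](cardsD1 x T) xT.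
  have := @generic_dirs p x (T :\ x) gp; rewrite setD11 cTx leqnn => /(_ isT isT) rx.
  apply: (@leq_trans (\rank (dirs p x (T :\ x)))); first by rewrite rx.
  apply/mxrankS/dirs_subP => t; rewrite !inE => /andP[tx tT].
  have tv : (t == v) = false by apply/negbTE; apply: contraNneq vT => <-.
  have -> : \row_i (p x i - p t i) = \row_i (q v i - q t i) - \row_i (q v i - q x i) :> 'rV[R]_d.
    apply/rowP => i; rewrite !mxE qv qx /q /move_to tv /a. lra.
  by apply: addmx_sub; rewrite ?eqmx_opp ?dir_sub.
rewrite -addSnnS; apply: leq_trans (leq_add rB rd) _.
apply: rank_extend => //.
- rewrite -addsmxE addsmx_sub RigS //=.
  (* At the midpoint the two blocks of [v] cancel, and the blocks of [x] and [y] are half those of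
     the row of [xy]. *)
  have -> : rho q (x, y) = 2 *: (rho q (v, x) + rho q (v, y)).
    apply/rowP => j; by rewrite !mxE /= qx qy qv /a; field.
  by apply: scalemx_sub; apply: addmx_sub; rewrite rho_sub ?TF'.
- by rewrite mul_col_mx Rig_proj0 // rho_proj eq_sym vx eq_sym vy subrr scale0r col_mx0.
Qed.
End RigidityMatrix.

(** * Gluing along [d] common neighbours, and the rank of complete graphs *)

Section Gluing.
Variables (R : realType) (n d : nat).
Implicit Types (p : 'I_n -> 'I_d -> R) (T W : {set 'I_n}).
Local Notation N := #|{: 'I_n * 'I_d}|.

(** The products of the coefficients of an affine dependency form a stress: the force at [i] is
    [l i * p i] times the sum of the [l j], minus [l i] times the sum of the [l j * p j], and both
    sums vanish. *)
Lemma equilibrium_stress p (l : 'I_n -> R) :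
  \sum_i l i = 0 -> (forall k, \sum_i l i * p i k = 0) ->
  \sum_(ij : 'I_n * 'I_n) (l ij.1 * l ij.2) *: rho p ij = 0.
Proof.
move=> l0 lp0; apply/rowP => c; rewrite summxE mxE.
case cE: (enum_val c) => [u k].
have half i : \sum_j l i * l j * (p i k - p j k) = 0.
  transitivity (l i * p i k * (\sum_j l j) - l i * \sum_j l j * p j k).
    by rewrite !mulr_sumr -sumrB; apply: eq_bigr => j _; ring.
  by rewrite l0 lp0 !mulr0 subrr.
transitivity (\sum_i \sum_j ((u == i)%:R * (l i * l j * (p i k - p j k))
    + (u == j)%:R * (l j * l i * (p j k - p i k)))).
  rewrite pair_bigA /=; apply: eq_bigr => -[i j] _.
  by rewrite !mxE /= cE /=; ring.
under eq_bigr do rewrite big_split /=.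
rewrite big_split /= [X in _ + X]exchange_big /=.
by rewrite !big1 ?addr0 // => i _; rewrite -mulr_sumr half mulr0.
Qed.

(** The directions from [w] to [T] form a basis, which yields [c]. If its coefficients summed to 1,
    they would be a linear relation among the directions from [x] to [T], which are independent
    too. *)
Lemma affine_dependency p T x w : generic p -> x \notin T -> w \notin T ->
  #|T| = d -> exists2 c : 'I_n -> R, \sum_(t in T) c t != 1 &
    forall k, p w k - p x k = \sum_(t in T) c t * (p w k - p t k).
Proof.
move=> gp xT wT cT.
have full : row_full (dirs p w T) by rewrite /row_full generic_dirs ?cT.
have /submxP[c cE] := submx_full (\row_i (p w i - p x i)) full.
have {}cE k : p w k - p x k = \sum_(t in T) c 0 t * (p w k - p t k).
  have /rowP/(_ k) := cE; rewrite !mxE => ->; rewrite [RHS]big_mkcond /=.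
  by apply: eq_bigr => t _; rewrite !mxE; case: ifP => _; rewrite !mxE ?mulr0.
exists (c 0) => //; apply/eqP => s1.
have [t0 t0T ct0] : exists2 t, t \in T & c 0 t != 0.
  apply/exists_inP; apply: contraTT isT => /exists_inPn c0.
  move: s1; rewrite big1 => [/esym/eqP|t /c0 /negPn/eqP//].
  by rewrite oner_eq0.
have xE k : \sum_(t in T) c 0 t * (p x k - p t k) = 0.
  transitivity ((\sum_(t in T) c 0 t * (p w k - p t k))
      - (p w k - p x k) * \sum_(t in T) c 0 t); last by rewrite s1 -cE; ring.
  by rewrite mulr_sumr -sumrB; apply: eq_bigr => t _; ring.
have : (dirs p x T <= dirs p x (T :\ t0))%MS.
  apply/dirs_subP => t tT; have [->|tt0] := eqVneq t t0; last first.
    by apply: dir_sub; rewrite !inE tt0.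
  have -> : \row_i (p x i - p t0 i)
      = \sum_(t in T :\ t0) (- (c 0 t0)^-1 * c 0 t) *: \row_i (p x i - p t i) :> 'rV[R]_d.
    apply/rowP => k; rewrite summxE !mxE; apply: (mulfI ct0).
    move: (xE k); rewrite (big_setD1 t0) //= => /eqP; rewrite addr_eq0 => /eqP->.
    rewrite mulr_sumr -sumrN; apply: eq_bigr => t1 _; rewrite !mxE.
    by field.
  by apply: summx_sub => t1 t1T; apply: scalemx_sub; exact: dir_sub.
move/mxrankS; have cT0 : (#|T :\ t0| < d)%N by rewrite -cT [ltnRHS](cardsD1 t0) t0T.
rewrite !generic_dirs ?cT ?(ltnW cT0) //; first by rewrite leqNgt cT0.
by rewrite !inE (negbTE xT) andbF.
Qed.

(** The points of [x], [w] and [T] are affinely dependent. The resulting stress has a nonzero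
    coefficient at [xw], so it expresses this row by those of the other pairs, all of which lie in
    the span of [B]. *)
Lemma glue p m (B : 'M[R]_(m, N)) T x w : generic p ->
  x \notin T -> w \notin T -> #|T| = d ->
  (forall t t', t \in T -> t' \in T -> (rho p (t, t') <= B)%MS) ->
  (forall t, t \in T -> (rho p (x, t) <= B)%MS) ->
  (forall t, t \in T -> (rho p (w, t) <= B)%MS) ->
  (rho p (x, w) <= B)%MS.
Proof.
move=> gp xT wT cT TB xB wB.
have [->|xw] := eqVneq x w; first by rewrite rhoxx sub0mx.
have [c s1 cE] := affine_dependency gp xT wT cT.
pose s := \sum_(t in T) c t.
pose l i := if i == w then 1 - s else if i == x then - 1 else if i \in T then c i else 0.
have lsum (f : 'I_n -> R) :
    \sum_i l i * f i = (1 - s) * f w - f x + \sum_(t in T) c t * f t.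
  rewrite (bigD1 w) //= (bigD1 x) //= /l eqxx (negbTE xw) eqxx mulN1r addrA.
  congr (_ + _); rewrite big_mkcond [RHS]big_mkcond /=; apply: eq_bigr => i _.
  have [->|iw] := eqVneq i w; first by rewrite (negbTE wT).
  have [->|ix] := eqVneq i x; first by rewrite (negbTE xT).
  by rewrite /=; case: ifP; rewrite ?mul0r.
have l0 : \sum_i l i = 0.
  have := lsum (fun=> 1); under eq_bigr do rewrite mulr1; move=> ->.
  by rewrite mulr1; under eq_bigr do rewrite mulr1; rewrite -/s; ring.
have lp0 k : \sum_i l i * p i k = 0.
  rewrite lsum; have -> : (1 - s) * p w k = p w k - \sum_(t in T) c t * p w k.
    by rewrite -mulr_suml -/s; ring.
  have := cE k; under eq_bigr do rewrite mulrBr.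
  rewrite sumrB; set X := \sum_(t in T) _; set Y := \sum_(t in T) _; lra.
have := equilibrium_stress l0 lp0; rewrite (bigD1 (x, w)) //= (bigD1 (w, x)) /=; last first.
  by rewrite xpair_eqE negb_and eq_sym xw.
rewrite [rho p (w, x)]rhoC addrA -scalerDl => /eqP; rewrite addr_eq0 => /eqP H.
(* The pair occurs in both orders; the coefficient is nonzero because [s] differs from 1. *)
have lxw : l x * l w + l w * l x = - 2 * (1 - s).
  by rewrite /l eqxx (negbTE xw) eqxx; ring.
have nz : - 2 * (1 - s) != 0 :> R.
  by rewrite mulf_neq0 ?oppr_eq0 ?pnatr_eq0 // subr_eq0 eq_sym.
rewrite -(eqmx_scale _ nz) -lxw H eqmx_opp.
apply: summx_sub => -[i j] /=; rewrite !xpair_eqE => /andP[nxw nwx].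
rewrite /l.
have [iw|iw] := eqVneq i w; have [jw|jw] := eqVneq j w.
- by rewrite iw jw rhoxx scaler0 sub0mx.
- rewrite iw; have [jx|jx] := eqVneq j x; first by rewrite iw jx !eqxx in nwx.
  by case: ifP => [jT|]; rewrite ?mulr0 ?scale0r ?sub0mx // scalemx_sub // wB.
- rewrite jw; have [ix|ix] := eqVneq i x; first by rewrite jw ix !eqxx in nxw.
  by case: ifP => [iT|]; rewrite ?mul0r ?scale0r ?sub0mx // rhoC scalemx_sub // wB.
- have [ix|ix] := eqVneq i x; have [jx|jx] := eqVneq j x.
  + by rewrite ix jx rhoxx scaler0 sub0mx.
  + rewrite ix; case: ifP => [jT|]; rewrite ?mulr0 ?scale0r ?sub0mx //.
    by rewrite scalemx_sub // xB.
  + rewrite jx; case: ifP => [jT|]; rewrite ?mul0r ?scale0r ?sub0mx //.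
    by rewrite rhoC scalemx_sub // xB.
  case: (ifP (i \in T)) => [iT|]; rewrite ?mul0r ?scale0r ?sub0mx //.
  case: ifP => [jT|]; rewrite ?mulr0 ?scale0r ?sub0mx //.
  by rewrite scalemx_sub // TB.
Qed.

Definition pairs_in W : {set 'I_n * 'I_n} := setX W W.

(** It suffices to add the rows from [v] to [minn d #|W|] vertices of [W]: if some vertex of [W] is
    left over, there are [d] of them and [glue] supplies the remaining pairs. *)
Lemma rank_complete_add p v W : generic p -> v \notin W ->
  (\rank (Rig p (pairs_in (v |: W))) <= \rank (Rig p (pairs_in W)) + minn d #|W|)%N.
Proof.
move=> gp vW.
have [T TW cT] := subset_of_card (geq_minr d #|W|).
pose D := \matrix_(k < #|T|) rho p (v, enum_val k).
apply: (@leq_trans (\rank (Rig p (pairs_in W) + D)%MS)); last first.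
  rewrite -cT; apply: leq_trans (mxrank_adds_leqif _ _) _.
  by rewrite leq_add2l rank_leq_row.
have DT t : t \in T -> (rho p (v, t) <= Rig p (pairs_in W) + D)%MS.
  move=> tT; apply: submx_trans (addsmxSr _ _).
  have -> : rho p (v, t) = row (enum_rank_in tT t) D by rewrite rowK enum_rankK_in.
  exact: row_sub.
have WW u w : u \in W -> w \in W -> (rho p (u, w) <= Rig p (pairs_in W) + D)%MS.
  move=> uW wW; apply: submx_trans (addsmxSl _ _).
  by apply: rho_sub; rewrite in_setX uW.
have vv w : w \in W -> (rho p (v, w) <= Rig p (pairs_in W) + D)%MS.
  move=> wW; have [/DT//|wT] := boolP (w \in T).
  have cTd : #|T| = d.
    have /proper_card : T \proper W by apply/properP; split => //; exists w.
    by rewrite cT gtn_min ltnn orbF; case: leqP => // dW _; rewrite (minn_idPl _) // ltnW.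
  rewrite rhoC; apply: (glue (T := T)) => //.
  - by apply: contra vW => /(subsetP TW).
  - by move=> t t' /(subsetP TW) tW /(subsetP TW); exact: WW.
  - by move=> t /(subsetP TW); exact: WW.
apply/mxrankS/Rig_subP => -[u w]; rewrite in_setX /= !inE.
move=> /andP[/orP[/eqP->|uW] /orP[/eqP->|wW]].
- by rewrite rhoxx sub0mx.
- exact: vv.
- by rewrite rhoC vv.
- exact: WW.
Qed.

Lemma rank_complete p W : generic p ->
  (\rank (Rig p (pairs_in W)) <= \sum_(i < #|W|) minn d i)%N.
Proof.
move=> gp; move kE : #|W| => k; elim: k W kE => [|k IH] W kE.
  have -> : Rig p (pairs_in W) = 0; last by rewrite mxrank0.
  apply/matrixP => i j; rewrite !mxE (cards0_eq kE).
  by case: (enum_val i) => u w; rewrite in_setX inE mxE.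
have /card_gt0P[v vW] : (0 < #|W|)%N by rewrite kE.
rewrite -(setD1K vW) big_ord_recr /=.
have kE' : #|W :\ v| = k by apply/eqP; rewrite -eqSS -kE [eqbRHS](cardsD1 v) vW.
apply: leq_trans (rank_complete_add gp _) _; first by rewrite setD11.
by rewrite kE' leq_add2r IH.
Qed.

(** The value [d k - d(d+1)/2], doubled and free of subtraction. *)
Lemma sum_minn k : (d <= k)%N -> (2 * \sum_(i < k) minn d i + d * d.+1 = 2 * d * k)%N.
Proof.
move=> /subnK <-; elim: (k - d)%N => [|j IH]; last first.
  rewrite addSn big_ord_recr /= (minn_idPl (leq_addl _ _)).
  by move: IH; set S := bigop _ _ _; nia.
rewrite add0n (eq_bigr (fun i : 'I_d => i : nat)); last first.
  by move=> i _; rewrite (minn_idPr (ltnW (ltn_ord i))).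
elim: (d) => [|m IHm]; first by rewrite big_ord0.
by rewrite big_ord_recr /=; move: IHm; set S := bigop _ _ _; nia.
Qed.
End Gluing.

(** * Closed graphs *)

Section ClosedGraph.
Variables (n d : nat) (e : rel 'I_n) (rk : {set 'I_n} -> nat).
Implicit Types (u v w x y : 'I_n) (W X A : {set 'I_n}).

Definition nbrs W v : {set 'I_n} := [set w in W | e v w].

Definition clique A : bool := [forall x in A, forall y in A, (x != y) ==> e x y].

Lemma cliqueP A :
  reflect (forall x y, x \in A -> y \in A -> x != y -> e x y) (clique A).
Proof.
apply: (iffP forall_inP) => H.
  by move=> x y xA yA xy; have /forall_inP/(_ y yA)/implyP := H x xA; apply.
by move=> x xA; apply/forall_inP => y yA; apply/implyP; exact: H.
Qed.

Lemma cliquePn A : ~~ clique A ->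
  exists x y, [/\ x \in A, y \in A, x != y & ~~ e x y].
Proof.
move=> /forall_inPn[x xA /forall_inPn[y yA]]; rewrite negb_imply => /andP[xy nxy].
by exists x, y.
Qed.

Lemma cliqueS A X : A \subset X -> clique X -> clique A.
Proof.
move=> /subsetP AX /cliqueP H; apply/cliqueP => x y /AX xX /AX yX; exact: H.
Qed.

Hypothesis e_sym : ssrbool.symmetric e.
Hypothesis e_irr : irreflexive e.
Hypothesis e_glue : forall X x w, clique X -> #|X| = d -> x \notin X -> w \notin X ->
  x != w -> (forall t, t \in X -> e x t) -> (forall t, t \in X -> e w t) -> e x w.
Hypothesis rk_0ext : forall W v, v \notin W ->
  (rk W + minn d #|nbrs W v| <= rk (v |: W))%N.
Hypothesis rk_1ext : forall W v, v \notin W -> (d < #|nbrs W v|)%N ->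
  ~~ clique (nbrs W v) -> (rk W + d.+1 <= rk (v |: W))%N.

Lemma nbrs_sub W v : nbrs W v \subset W.
Proof. by apply/subsetP => w; rewrite inE => /andP[]. Qed.

(** Any [d] neighbours of [w] in [X] form a clique along which [w] is glued to each further vertex
    of [X]. *)
Lemma clique_absorb X w : clique X -> w \notin X -> (d <= #|nbrs X w|)%N ->
  forall x, x \in X -> e x w.
Proof.
move=> cX wX dX x xX; apply: contraT => nxw; rewrite -(negbTE nxw).
have [T TX cT] := subset_of_card dX.
have TX' : T \subset X by apply: subset_trans TX (nbrs_sub _ _).
have wT t : t \in T -> e w t by move=> /(subsetP TX); rewrite inE => /andP[].
have xT : x \notin T by apply: contra nxw => /wT; rewrite e_sym.
apply: (e_glue (cliqueS TX' cX)) => //.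
- by apply: contra wX => /(subsetP TX').
- by apply: contraNneq wX => <-.
- move=> t tT; move/cliqueP: cX; apply => //; first by rewrite (subsetP TX').
  by apply: contraNneq xT => ->.
Qed.

(* At most one deletion can turn a non-clique neighbourhood into a clique:
   two such cliques through [v] share [d] vertices, so would be glued. *)
Lemma clique_deletion_unique v A x y : (forall w, w \in A -> e v w) ->
  (d < #|A|)%N -> ~~ clique A -> x \in A -> y \in A ->
  clique (A :\ x) -> clique (A :\ y) -> x = y.
Proof.
move=> vA dA nA xA yA cx cy; apply/eqP; apply: contraNT nA => xy.
have vNA : v \notin A by apply/negP => /vA; rewrite e_irr.
have vx : v != x by apply: contraNneq vNA => ->.
pose X := v |: (A :\ x).
have cX : clique X.
  apply/cliqueP => a b; rewrite !in_setU1 => /orP[/eqP->|aA] /orP[/eqP->|bA] ab.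
  - by rewrite eqxx in ab.
  - by apply: vA; move: bA; rewrite inE => /andP[].
  - by rewrite e_sym; apply: vA; move: aA; rewrite inE => /andP[].
  - by move/cliqueP: cx; apply.
have xX : x \notin X by rewrite !inE eqxx eq_sym (negbTE vx).
(* [x] is adjacent to [v] and, through the clique [A :\ y], to the at least [d - 1] members of [A]
   other than [x] and [y]. *)
have dX : (d <= #|nbrs X x|)%N.
  have sub : v |: (A :\ x :\ y) \subset nbrs X x.
    apply/subsetP => t; rewrite !inE => /orP[/eqP->|/and3P[ty tx tA]].
      by rewrite eqxx e_sym vA.
    rewrite tx tA orbT /=; move/cliqueP: cy; apply; rewrite ?inE ?ty ?tA ?xy ?xA //.
    by rewrite eq_sym.
  apply: leq_trans (subset_leq_card sub); rewrite cardsU1 !inE (negbTE vNA) !andbF /=.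
  move: dA; rewrite (cardsD1 x) xA (cardsD1 y (A :\ x)) !inE eq_sym xy yA /=.
  by rewrite !add1n !ltnS.
have xall := clique_absorb cX xX dX.
apply/cliqueP => a b aA bA ab.
have [ax|ax] := eqVneq a x; have [bx|bx] := eqVneq b x.
- by rewrite ax bx eqxx in ab.
- by rewrite ax e_sym xall // !inE bx bA orbT.
- by rewrite bx xall // !inE ax aA orbT.
- by move/cliqueP: cx; apply; rewrite ?inE ?ax ?bx.
Qed.

(** Twice the expected gain of a vertex with [D] neighbours in a random order, [c] telling whether
    they form a clique. The first two values are the exact averages of [minn d k] over [k] from 0 to
    [D]; the third solves the recursion of [psi_local] in the worst case, where exactly one deletion
    leaves a clique. *)
Definition psi (D : nat) (c : bool) : rat :=
  if (D <= d)%N then D%:R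
  else if c then 2 * d%:R - (d * d.+1)%:R / D.+1%:R
  else 2 * d%:R + 1 - (d * d.+1)%:R / D%:R.

Definition gain (D : nat) (c : bool) : nat :=
  if (D <= d)%N then D else if c then d else d.+1.

Lemma psi_clique D : (d <= D)%N -> psi D true = 2 * d%:R - (d * d.+1)%:R / D.+1%:R.
Proof.
rewrite /psi leq_eqVlt => /orP[/eqP<-|]; last by rewrite ltnNge => /negbTE->.
rewrite leqnn natrM mulfK ?pnatr_eq0 //; ring.
Qed.

Lemma psi_nclique D : (0 < d)%N -> (d <= D)%N ->
  psi D false = 2 * d%:R + 1 - (d * d.+1)%:R / D%:R.
Proof.
move=> d0; rewrite /psi leq_eqVlt => /orP[/eqP<-|]; last by rewrite ltnNge => /negbTE->.
rewrite leqnn natrM mulrAC mulfV ?pnatr_eq0 -?lt0n // -natr1; ring.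
Qed.

(** Conditioning on which of [v] and its neighbours comes last: if it is [v], its gain is realised;
    if it is [w], the neighbourhood of [v] loses [w]. *)
Lemma psi_local v A : (0 < d)%N -> (forall w, w \in A -> e v w) ->
  #|A|.+1%:R * psi #|A| (clique A) <=
  2 * (gain #|A| (clique A))%:R + \sum_(w in A) psi #|A|.-1 (clique (A :\ w)).
Proof.
move=> d0 vA; have [Ad|dA] := leqP #|A| d.
  rewrite /psi /gain Ad (leq_trans (leq_pred _) Ad) sumr_const.
  rewrite -[#|A|.-1%:R *+ _]mulr_natr -!natrM -natrD ler_nat.
  by case: #|A| => [|m] //=; nia.
have A0 : (0 < #|A|)%N by apply: leq_trans dA.
case AE: #|A| A0 dA => [//|m] _ dm /=.
have m0 : (0 < m)%N by exact: leq_trans d0 dm.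
have [cA|nA] := boolP (clique A).
  rewrite (eq_bigr (fun=> psi m true)); last first.
    by move=> w wA; rewrite (cliqueS (subsetDl _ _) cA).
  rewrite sumr_const AE /gain leqNgt dm /= !psi_clique ?(ltnW dm) // -[(_ - _) *+ _]mulr_natr.
  have H1 : m.+1%:R != 0 :> rat by rewrite pnatr_eq0.
  have H2 : m.+2%:R != 0 :> rat by rewrite pnatr_eq0.
  rewrite le_eqVlt; apply/orP; left; apply/eqP.
  rewrite mulrBr mulrBl [X in _ - X]mulrCA mulfV // mulfVK // -!natr1; ring.
rewrite /gain leqNgt dm /= psi_nclique ?(ltnW dm) //.
(* For [c = false] the difference is [1 - d(d+1)/(m(m+1))], nonnegative since [d <= m]. *)
have psi_le c : psi m true <= psi m c.
  case: c => //; rewrite psi_clique // psi_nclique //.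
  have m0' : 0 < m%:R :> rat by rewrite ltr0n.
  have K : (d * d.+1)%:R <= m%:R * m.+1%:R :> rat by rewrite -natrM ler_nat leq_mul.
  have : (d * d.+1)%:R / (m%:R * m.+1%:R) <= 1 :> rat.
    by rewrite ler_pdivrMr ?mul1r // mulr_gt0 // ltr0n.
  have -> : (d * d.+1)%:R / (m%:R * m.+1%:R) = (d * d.+1)%:R / m%:R - (d * d.+1)%:R / m.+1%:R :> rat.
    have H1 : m%:R + 1 != 0 :> rat by rewrite natr1 pnatr_eq0.
    by rewrite -natr1; field; rewrite ?H1 ?(gt_eqF m0').
  by set a := _ / m%:R; set b := _ / m.+1%:R => ab; lra.
(* At most one deletion leaves a clique; if none does, [psi_le] absorbs the difference. *)
have : psi m true + m%:R * psi m false <= \sum_(w in A) psi m (clique (A :\ w)).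
  have [/existsP[x /andP[xA cx]]|] := boolP [exists x, (x \in A) && clique (A :\ x)].
    rewrite (big_setD1 x) //= cx lerD2l (eq_bigr (fun=> psi m false)).
      rewrite sumr_const; have -> : #|A :\ x| = m.
        by apply/eqP; rewrite -eqSS -AE [eqbRHS](cardsD1 x) xA.
      by rewrite -[X in _ <= X]mulr_natl.
    move=> w; rewrite !inE => /andP[wx wA]; congr psi.
    apply: contraNF wx => cw; apply/eqP.
    by apply: (clique_deletion_unique vA _ nA wA xA cw cx); rewrite AE.
  rewrite negb_exists => /forallP nx; rewrite (eq_bigr (fun=> psi m false)).
    rewrite sumr_const AE -[X in _ <= X]mulr_natl -natr1 mulrDl mul1r addrC lerD2l.
    exact: psi_le.
  by move=> w wA; have := nx w; rewrite wA /= => /negbTE->.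
rewrite psi_clique // psi_nclique // => H.
apply: le_trans (lerD (lexx _) H); rewrite le_eqVlt; apply/orP; left; apply/eqP.
have m0' : m%:R != 0 :> rat by rewrite pnatr_eq0 -lt0n.
have m1' : m%:R + 1 != 0 :> rat by rewrite natr1 pnatr_eq0.
by rewrite -!natr1; field; rewrite ?m0' ?m1'.
Qed.

Definition pot W v : rat := psi #|nbrs W v| (clique (nbrs W v)).

Lemma nbrsD1 W v w : nbrs (W :\ w) v = nbrs W v :\ w.
Proof. by apply/setP => x; rewrite !inE andbA. Qed.

(** Deleting a vertex that is neither [v] nor a neighbour of [v] leaves the potential of [v]
    unchanged, so each such vertex adds the same term to both sides of [psi_local]. *)
Lemma pot_local W v : (0 < d)%N -> v \in W ->
  #|W|%:R * pot W v <=
  2 * (gain #|nbrs W v| (clique (nbrs W v)))%:R + \sum_(w in W :\ v) pot (W :\ w) v.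
Proof.
move=> d0 vW; set A := nbrs W v.
have vA w : w \in A -> e v w by rewrite inE => /andP[].
have AW : A \subset W :\ v.
  apply/subsetP => w; rewrite !inE => /andP[-> vw]; rewrite andbT.
  by apply: contraTneq vw => ->; rewrite e_irr.
have -> : #|W|%:R = #|A|.+1%:R + #|(W :\ v) :\: A|%:R :> rat.
  by rewrite -natrD (cardsD1 v W) vW [#|_ :\: A|]cardsD (setIidPr AW) addSn subnKC ?subset_leq_card.
rewrite mulrDl (big_setID A) /= (setIidPr AW) addrA lerD //.
  apply: le_trans (psi_local d0 vA) _; rewrite lerD2l ler_sum // => w wA.
  by rewrite /pot nbrsD1 (cardsD1 w A) wA.
rewrite (eq_bigr (fun=> pot W v)); first by rewrite sumr_const -[leRHS]mulr_natl.
move=> w; rewrite !inE => /and3P[nwA _ _].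
have wA : w \notin A by rewrite inE.
by rewrite /pot nbrsD1 (setDidPl _) // disjoint_sym disjoints1.
Qed.

Lemma rk_gain W v : v \in W ->
  (rk (W :\ v) + gain #|nbrs W v| (clique (nbrs W v)) <= rk W)%N.
Proof.
move=> vW; have vD : v \notin W :\ v by rewrite setD11.
have E : nbrs (W :\ v) v = nbrs W v.
  rewrite nbrsD1; apply/setDidPl; rewrite disjoint_sym disjoints1 inE e_irr.
  by rewrite andbF.
rewrite -[in leqRHS](setD1K vW) /gain -E.
case: (leqP #|nbrs (W :\ v) v| d) => [le|lt].
  by have := rk_0ext vD; rewrite (minn_idPr le).
case: ifPn => [_|nc]; last exact: rk_1ext.
by have := rk_0ext vD; rewrite (minn_idPl (ltnW lt)).
Qed.

(* [pot W v / 2] bounds from below the expected rank gain of [v] when the vertices of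
   [W] are added in a uniformly random order; the induction averages over the last one. *)
Lemma rk_lower_bound W : (0 < d)%N -> \sum_(v in W) pot W v <= 2 * (rk W)%:R.
Proof.
move=> d0; move kE : #|W| => k; elim: k W kE => [|k IH] W kE.
  by rewrite (cards0_eq kE) big_set0 mulr_ge0.
have k0 : 0 < k.+1%:R :> rat by rewrite ltr0n.
rewrite -(ler_pM2l k0) mulr_sumr.
have step v : v \in W -> k.+1%:R * pot W v <=
    2 * (gain #|nbrs W v| (clique (nbrs W v)))%:R + \sum_(w in W :\ v) pot (W :\ w) v.
  by move=> vW; rewrite -kE; exact: pot_local.
apply: le_trans (ler_sum _ step) _; rewrite big_split /=.
(* Grouping by the deleted vertex [w] makes the inner sum the total potential of [W :\ w], to which
   the induction hypothesis applies. *)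
have -> : \sum_(v in W) \sum_(w in W :\ v) pot (W :\ w) v
    = \sum_(w in W) \sum_(v in W :\ w) pot (W :\ w) v.
  rewrite (exchange_big_dep (mem W)) /=; last by move=> v w _; rewrite inE => /andP[].
  apply: eq_bigr => w wW; apply: eq_bigl => v; rewrite !inE eq_sym wW andbT.
  by rewrite andbC.
rewrite -big_split /=.
have -> : k.+1%:R * (2 * (rk W)%:R) = \sum_(w in W) (2 * (rk W)%:R) :> rat.
  by rewrite sumr_const kE -[RHS]mulr_natl.
apply: ler_sum => w wW.
have cW : #|W :\ w| = k by apply/eqP; rewrite -eqSS -kE [eqbRHS](cardsD1 w) wW.
apply: le_trans (lerD (lexx _) (IH _ cW)) _.
rewrite -mulrDr ler_pM2l ?ltr0n // -natrD ler_nat addnC; exact: rk_gain.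
Qed.
Local Notation N := (nbrs setT).
Hypothesis d_gt0 : (0 < d)%N.
Hypothesis n_ge : (d * (d + 2) <= n)%N.
Hypothesis e_degree_sum : forall x y, x != y -> ~~ e x y ->
  (n + d <= #|N x| + #|N y| + 2)%N.
Hypothesis rk_le : (2 * rk setT + d * d.+1 <= 2 * d * n)%N.

Lemma in_N v w : (w \in N v) = e v w.
Proof. by rewrite !inE. Qed.

(** Inclusion-exclusion: the union of the two neighbourhoods misses both [x] and [y], so it has at
    most [n - 2] elements. *)
Lemma common_nbrs x y : x != y -> ~~ e x y -> (d <= #|N x :&: N y|)%N.
Proof.
move=> xy nxy; have := e_degree_sum xy nxy; rewrite -cardsUI.
have : (#|N x :|: N y| + 2 <= n)%N.
  rewrite -[leqRHS]card_ord -(cardsC (N x :|: N y)) leq_add2l.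
  have <- : #|[set x; y]| = 2%N by rewrite cards2 xy.
  apply/subset_leq_card/subsetP => z; rewrite !inE => /orP[/eqP->|/eqP->].
    by rewrite e_irr /= e_sym.
  by rewrite e_irr (negbTE nxy).
lia.
Qed.

(** Otherwise [v] and its neighbours form a clique that absorbs every other vertex by [common_nbrs].
    Then [v] is adjacent to all vertices and the graph is complete. *)
Lemma nonsimplicial x0 y0 v : x0 != y0 -> ~~ e x0 y0 -> ~~ clique (N v).
Proof.
move=> xy0 nxy0; apply/negP => cN.
have cX : clique (v |: N v).
  apply/cliqueP => a b; rewrite !in_setU1 !in_N => /orP[/eqP->|va] /orP[/eqP->|vb] ab.
  - by rewrite eqxx in ab.
  - by [].
  - by rewrite e_sym.
  - by move/cliqueP: cN; apply; rewrite ?in_N.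
have vall u : u != v -> e v u.
  move=> uv; apply: contraT => nvu; rewrite -(negbTE nvu).
  apply: (clique_absorb cX); rewrite ?setU11 // ?in_setU1 ?in_N ?negb_or ?uv //.
  apply: leq_trans (common_nbrs _ nvu) _; first by rewrite eq_sym.
  by apply/subset_leq_card/subsetP => w; rewrite !inE /= => /andP[-> ->]; rewrite orbT.
have [xv|xv] := eqVneq x0 v; first by rewrite xv vall // -xv eq_sym in nxy0.
have [yv|yv] := eqVneq y0 v; first by rewrite e_sym yv vall in nxy0.
by move/cliqueP: cN => /(_ x0 y0); rewrite !in_N !vall // (negbTE nxy0) => /(_ isT isT xy0).
Qed.

(** If [v] has at most [d] neighbours, each non-neighbour is adjacent to all of them, and by the
    degree condition to every vertex but [v] and itself. The non-neighbours thus form a clique [M]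
    of size at least [d]; gluing along [M] makes the neighbourhood of [v] a clique, against
    [nonsimplicial]. *)
Lemma degree_gt x0 y0 v : x0 != y0 -> ~~ e x0 y0 -> (d < #|N v|)%N.
Proof.
move=> xy0 nxy0; rewrite ltnNge; apply/negP => Nd.
have NM u : u != v -> ~~ e v u -> N v \subset N u.
  move=> uv nvu; have vu : v != u by rewrite eq_sym.
  have := leq_trans Nd (common_nbrs vu nvu).
  have S : N v :&: N u \subset N v by exact: subsetIl.
  by rewrite (geq_leqif (subset_leqif_cards S)) => /eqP <-; exact: subsetIr.
pose M := ~: (v |: N v).
have MP u : u \in M = (u != v) && ~~ e v u by rewrite !inE negb_or.
have cM : clique M.
  apply/cliqueP => a b; rewrite !MP => /andP[av nva] /andP[bv nvb] ab.
  have Na : N a \subset ~: [set a; v].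
    apply/subsetP => z; rewrite !inE /= negb_or => az; apply/andP; split.
      by apply: contraTneq az => ->; rewrite e_irr.
    by apply: contraTneq az => ->; rewrite e_sym.
  have va : v != a by rewrite eq_sym.
  have := e_degree_sum va nva; move=> H.
  have cav : #|~: [set a; v]| = (n - 2)%N.
    by rewrite cardsCs setCK cards2 av card_ord.
  have : (#|~: [set a; v]| <= #|N a|)%N by rewrite cav; lia.
  rewrite (geq_leqif (subset_leqif_cards Na)) => /eqP E.
  by rewrite -in_N E !inE negb_or eq_sym ab.
have dM : (d <= #|M|)%N.
  rewrite cardsCs setCK cardsU1 in_N e_irr card_ord /=.
  have := leq_pmulr d d_gt0; move: n_ge Nd; rewrite mulnDr.
  by set k := #|_|; move: (d * d)%N k => dd k; lia.
case/negP: (nonsimplicial v xy0 nxy0); apply/cliqueP => t t'; rewrite !in_N => vt vt' tt'.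
have tM u : u \in M -> e t u.
  by rewrite MP => /andP[uv nvu]; rewrite e_sym -in_N; apply: (subsetP (NM u uv nvu)); rewrite in_N.
have t'M u : u \in M -> e t' u.
  by rewrite MP => /andP[uv nvu]; rewrite e_sym -in_N; apply: (subsetP (NM u uv nvu)); rewrite in_N.
have cX : clique (t |: M).
  apply/cliqueP => a b; rewrite !in_setU1 => /orP[/eqP->|aM] /orP[/eqP->|bM] ab.
  - by rewrite eqxx in ab.
  - exact: tM.
  - by rewrite e_sym tM.
  - by move/cliqueP: cM; apply.
apply: (clique_absorb cX); rewrite ?setU11 //.
  by rewrite in_setU1 MP eq_sym (negbTE tt') vt' andbF.
apply: leq_trans dM _; apply/subset_leq_card/subsetP => u uM.
by rewrite inE in_setU1 uM orbT t'M.
Qed.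

(** Let [u] have least degree. It contributes at most [1/(d+1)], and its neighbours at most 1
    together. Its [#|C|] non-neighbours have degree at least [#|C| + d - 1], so for [d > 1] they
    contribute less than 1. *)
Lemma sum_inv_degrees x0 y0 : (1 < d)%N -> x0 != y0 -> ~~ e x0 y0 ->
  \sum_v (#|N v|%:R : rat)^-1 < 2 + d.+1%:R^-1.
Proof.
move=> d1 xy0 nxy0; have Ngt v := degree_gt v xy0 nxy0.
pose u := [arg min_(v < x0) #|N v|].
have umin v : (#|N u| <= #|N v|)%N by rewrite /u; case: arg_minnP => // i _ ->.
have N0 v : 0 < #|N v|%:R :> rat by rewrite ltr0n (leq_trans _ (Ngt v)).
rewrite (bigD1 u) //= (bigID (e u)) /=.
pose C := [set v | (v != u) && ~~ e u v].
have cC : (#|C| + #|N u| + 1 = n)%N.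
  have -> : C = ~: (u |: N u) by apply/setP => v; rewrite !inE negb_or.
  by rewrite -[RHS]card_ord -(cardsC (u |: N u)) cardsU1 in_N e_irr /= add1n addn1 addSn addnC.
have H1 : (#|N u|%:R : rat)^-1 <= d.+1%:R^-1.
  by rewrite lef_pV2 ?posrE ?N0 ?ltr0n // ler_nat Ngt.
have sum_cst (P : pred 'I_n) (c : rat) : \sum_(v | P v) c = #|P|%:R * c.
  by rewrite sumr_const mulr_natl.
have H2 : \sum_(v | (v != u) && e u v) (#|N v|%:R : rat)^-1 <= 1.
  apply: (@le_trans _ _ (\sum_(v | (v != u) && e u v) (#|N u|%:R)^-1)).
    by apply: ler_sum => v _; rewrite lef_pV2 ?posrE // ler_nat.
  rewrite sum_cst (_ : #|_| = #|N u|) ?mulfV ?gt_eqF //.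
  apply: eq_card => v; rewrite in_N unfold_in; case: eqVneq => // ->.
  by rewrite e_irr.
have H3 : \sum_(v | (v != u) && ~~ e u v) (#|N v|%:R : rat)^-1 < 1.
  have M0 : 0 < (#|C| + d.-1)%:R :> rat by rewrite ltr0n; lia.
  apply: (@le_lt_trans _ _ (\sum_(v | (v != u) && ~~ e u v) ((#|C| + d.-1)%:R)^-1)).
    apply: ler_sum => v /andP[vu nuv]; rewrite lef_pV2 ?posrE // ler_nat.
    by rewrite eq_sym in vu; have := e_degree_sum vu nuv; lia.
  rewrite sum_cst (_ : #|_| = #|C|); last first.
    by apply: eq_card => v; rewrite inE.
  by rewrite ltr_pdivrMr // mul1r ltr_nat; lia.
rewrite [ltRHS]addrC; apply: ler_ltD => //; rewrite -[2]/(1 + 1).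
exact: ler_ltD.
Qed.

Lemma closed_graph_complete x0 y0 : x0 != y0 -> e x0 y0.
Proof.
move=> xy0; apply: contraT => nxy0.
(* For [d = 1] gluing makes adjacency transitive, so the neighbourhood of [x0] would be a clique. *)
have [d1|d1] := leqP d 1.
  have [x [y [xN yN xy nxy]]] := cliquePn (nonsimplicial x0 xy0 nxy0).
  move: xN yN; rewrite !in_N => vx vy; case/negP: nxy.
  have cX : clique [set x0; x].
    apply/cliqueP => a b; rewrite !inE => /orP[/eqP->|/eqP->] /orP[/eqP->|/eqP->];
      by rewrite ?eqxx // e_sym.
  apply: (clique_absorb cX); rewrite ?set22 //.
    rewrite !inE negb_or eq_sym [y == x]eq_sym xy andbT.
    by apply: contraTneq vy => <-; rewrite e_irr.
  apply: leq_trans d1 _; apply/card_gt0P; exists x0.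
  by rewrite !inE eqxx e_sym.
have S_lt := sum_inv_degrees d1 xy0 nxy0.
set S := \sum_v _ in S_lt.
(* With the upper bound on the rank this gives [n <= d(d+1)(S - 1) < d(d+1) + d = d(d+2)]. *)
have := rk_lower_bound setT d_gt0.
have -> : \sum_(v in setT) pot setT v = n%:R * (2 * d%:R + 1) - (d * d.+1)%:R * S.
  rewrite mulr_sumr -[X in X%:R * _]card_ord mulr_natl -sumr_const -sumrB.
  apply: eq_big => [v|v _]; first by rewrite inE.
  by rewrite /pot (negbTE (nonsimplicial v xy0 nxy0)) psi_nclique // ltnW // (degree_gt v xy0 nxy0).
have : (2 * rk setT + d * d.+1)%:R <= (2 * d * n)%:R :> rat by rewrite ler_nat.
have : (d * (d + 2))%:R <= n%:R :> rat by rewrite ler_nat.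
have : (d * d.+1)%:R * S < (d * d.+1)%:R * (2 + d.+1%:R^-1).
  by rewrite ltr_pM2l // ltr0n muln_gt0 d_gt0.
rewrite [X in _ < X -> _]mulrDr.
have -> : (d * d.+1)%:R * d.+1%:R^-1 = d%:R :> rat by rewrite natrM mulfK // pnatr_eq0.
move: ((d * d.+1)%:R * S) => KS.
rewrite !natrD !natrM !natrD -natr1; move: (d%:R : rat) (n%:R : rat) ((rk setT)%:R : rat).
by move=> D n' r; lra.
Qed.
End ClosedGraph.

(** * Closure of a graph in the generic rigidity matroid *)

Section GenericClosure.
Variables (R : realType) (n d : nat) (e : rel 'I_n) (p : 'I_n -> 'I_d -> R).
Implicit Types (u v w : 'I_n) (W X : {set 'I_n}).
Hypothesis gp : generic p.

Definition edges : {set 'I_n * 'I_n} := [set uv | e uv.1 uv.2].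

Definition closure_rel : rel 'I_n :=
  [rel u v | (u != v) && (rho p (u, v) <= Rig p edges)%MS].

Definition closure_edges W : {set 'I_n * 'I_n} :=
  [set uv | [&& closure_rel uv.1 uv.2, uv.1 \in W & uv.2 \in W]].

Definition closure_rank W : nat := \rank (Rig p (closure_edges W)).

Lemma closure_rel_sym : ssrbool.symmetric closure_rel.
Proof. by move=> u v; rewrite /closure_rel /= rhoC eq_sym. Qed.

Lemma closure_rel_irr : irreflexive closure_rel.
Proof. by move=> u; rewrite /closure_rel /= eqxx. Qed.

Lemma clique_rho X u v : clique closure_rel X -> u \in X -> v \in X ->
  (rho p (u, v) <= Rig p edges)%MS.
Proof.
move=> /cliqueP cX uX vX; have [->|uv] := eqVneq u v; first by rewrite rhoxx sub0mx.
by case/andP: (cX u v uX vX uv).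
Qed.

Lemma closure_glue X x w : clique closure_rel X -> #|X| = d ->
  x \notin X -> w \notin X -> x != w -> (forall t, t \in X -> closure_rel x t) ->
  (forall t, t \in X -> closure_rel w t) -> closure_rel x w.
Proof.
move=> cX Xd xX wX xw xt wt; rewrite /closure_rel /= xw; apply: (glue (T := X)) => //.
- by move=> t t'; exact: clique_rho.
- by move=> t /xt/andP[].
- by move=> t /wt/andP[].
Qed.

Lemma closure_edges_avoid W v : v \notin W -> avoids v (closure_edges W).
Proof.
move=> vW u w; rewrite inE /= => /and3P[_ uW wW].
by apply/andP; split; apply: contraNneq vW => <-.
Qed.

Lemma closure_edges_setU1 W v : closure_edges W \subset closure_edges (v |: W).
Proof.
apply/subsetP => uw; rewrite !inE => /and3P[-> -> ->].
by rewrite !orbT.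
Qed.

Lemma nbrs_closure_edges W v t : t \in nbrs closure_rel W v ->
  (v, t) \in closure_edges (v |: W).
Proof. by rewrite !inE => /andP[tW ->]; rewrite eqxx tW orbT. Qed.

Lemma nbrs_notin W v : v \notin nbrs closure_rel W v.
Proof. by rewrite inE closure_rel_irr andbF. Qed.

Lemma closure_rank_0ext W v : v \notin W ->
  (closure_rank W + minn d #|nbrs closure_rel W v| <= closure_rank (v |: W))%N.
Proof.
move=> vW; apply: (rank_0ext gp (closure_edges_avoid vW) (closure_edges_setU1 _ _)).
  exact: nbrs_notin.
exact: nbrs_closure_edges.
Qed.

Lemma closure_rank_1ext W v : (0 < d)%N -> v \notin W ->
  (d < #|nbrs closure_rel W v|)%N -> ~~ clique closure_rel (nbrs closure_rel W v) ->
  (closure_rank W + d.+1 <= closure_rank (v |: W))%N.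
Proof.
move=> d0 vW dN /cliquePn[x [y [xN yN xy nxy]]].
(* [rank_1ext] takes exactly [d + 1] neighbours: the nonadjacent [x] and [y] are completed by
   [d - 1] others. *)
pose A := nbrs closure_rel W v :\ x :\ y.
have cA : (d.-1 <= #|A|)%N.
  rewrite -ltnS (ltn_predK d0); move: dN.
  rewrite (cardsD1 x) xN (cardsD1 y (_ :\ x)) !inE in yN *.
  by rewrite eq_sym xy yN /= !add1n ltnS.
have [T TA cT] := subset_of_card cA.
have xT : x \notin T by apply/negP => /(subsetP TA); rewrite !inE eqxx andbF.
have yT : y \notin T by apply/negP => /(subsetP TA); rewrite !inE eqxx.
have TN : x |: (y |: T) \subset nbrs closure_rel W v.
  apply/subsetP => t; rewrite !in_setU1 => /or3P[/eqP->//|/eqP->//|/(subsetP TA)].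
  by rewrite !in_setD1 => /and3P[].
apply: (rank_1ext (T := x |: (y |: T)) (x := x) (y := y) gp (closure_edges_avoid vW)).
- exact: closure_edges_setU1.
- by apply: contra (nbrs_notin W v) => /(subsetP TN).
- by move=> t /(subsetP TN)/nbrs_closure_edges.
- by rewrite setU11.
- by rewrite setU1r // setU11.
- by rewrite !cardsU1 yT in_setU1 negb_or xy xT cT /= !add1n (ltn_predK d0).
(* Rows of closure edges already lie in the span of the rows of [e], so a row dependent on them
   would make [xy] a closure edge. *)
apply: contra nxy => H; rewrite /closure_rel /= xy; apply: submx_trans H _.
by apply/Rig_subP => -[a b]; rewrite inE /= => /and3P[/andP[]].
Qed.

Lemma closure_rank_le : (d <= n)%N ->
  (2 * closure_rank setT + d * d.+1 <= 2 * d * n)%N.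
Proof.
move=> dn; rewrite -(sum_minn dn) leq_add2r leq_mul2l /=.
have := rank_complete (setT : {set 'I_n}) gp; rewrite cardsT card_ord.
apply: leq_trans; apply/mxrankS/RigS; apply/subsetP => -[u v] _.
by rewrite in_setX !inE.
Qed.

(** Passing to the closure only adds edges, so the degree condition survives and
    [closed_graph_complete] applies. *)
Lemma generic_rigid_rows : (0 < d)%N -> (d * (d + 2) <= n)%N -> simple_graph e ->
  eta_ge e (n%:Z + d%:Z - 2) -> forall u v, (rho p (u, v) <= Rig p edges)%MS.
Proof.
move=> d0 dn [es ei] eta u v; have [->|uv] := eqVneq u v; first by rewrite rhoxx sub0mx.
suff /andP[] : closure_rel u v by [].
have ele x y : e x y -> closure_rel x y.
  move=> exy; apply/andP; split; last by apply: rho_sub; rewrite inE.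
  by apply: contraTneq exy => ->; rewrite ei.
apply: (closed_graph_complete (rk := closure_rank) closure_rel_sym closure_rel_irr
  closure_glue closure_rank_0ext _ d0 dn) => //.
- by move=> W w; exact: closure_rank_1ext.
- move=> x y xy nxy; have nexy : ~~ e x y by apply: contra nxy => /ele.
  have degle z : (deg e z <= #|nbrs closure_rel setT z|)%N.
    by apply/subset_leq_card/subsetP => t; rewrite inE => /ele H; rewrite !inE.
  have := eta x y xy nexy; have := degle x; have := degle y; lia.
- by apply: closure_rank_le; nia.
Qed.
End GenericClosure.

(** * Infinitesimal rigidity and continuous motions *)

Section UnitInterval.
Variable R : realType.
Implicit Types (f g : R -> R) (t : R).

(** The supremum of the points of [[0, t]] satisfying [P] satisfies [P] by closedness; were it below
    [t], openness would give a larger such point. *)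
Lemma unit_interval_connected (P : R -> Prop) : P 0 ->
  (forall t, in01 t -> P t ->
     exists2 delta, 0 < delta & forall s, in01 s -> `|s - t| < delta -> P s) ->
  (forall t, in01 t ->
     (forall delta, 0 < delta -> exists s, [/\ in01 s, `|s - t| < delta & P s]) -> P t) ->
  forall t, in01 t -> P t.
Proof.
move=> P0 Popen Pclosed t /andP[t0 t1].
pose A (s : R) := [/\ 0 <= s, s <= t & P s].
have A0 : A 0 by [].
have Asup : classical_sets.has_sup A by split; [exists 0|exists t => s []].
have s0 : 0 <= sup A by apply: sup_upper_bound.
have st : sup A <= t by apply: sup_le_ub; [exists 0|move=> s []].
have s01 : in01 (sup A) by rewrite /in01 s0 (le_trans st).
have Ps : P (sup A).
  apply: Pclosed => // delta delta0.
  have [a [a0 at_ Pa] lta] := sup_adherent delta0 Asup.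
  exists a; split=> //; first by rewrite /in01 a0 (le_trans at_).
  have : a <= sup A by apply: sup_upper_bound.
  by rewrite ltr_norml => ?; lra.
have [<-//|snt] := eqVneq (sup A) t.
have {}st : sup A < t by rewrite lt_neqAle snt.
have [delta delta0 Pdelta] := Popen _ s01 Ps.
pose s := Num.min (sup A + delta / 2) t.
have ss : sup A < s by rewrite lt_min st; lra.
have sle : s <= sup A + delta / 2 by rewrite ge_min lexx.
have slt : s <= t by rewrite ge_min lexx orbT.
have : s <= sup A.
  apply: sup_upper_bound => //; split=> //; first lra.
  apply: Pdelta; first by rewrite /in01; apply/andP; split; lra.
  by rewrite ltr_norml; apply/andP; split; lra.
lra.
Qed.

Definition cont01 f t : Prop := forall eps, 0 < eps -> exists2 delta, 0 < delta &
  forall s, in01 s -> `|s - t| < delta -> `|f s - f t| < eps.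

Lemma cont01_cst c t : cont01 (fun=> c) t.
Proof. by move=> eps eps0; exists 1 => // s _ _; rewrite subrr normr0. Qed.

Lemma cont01D f g t : cont01 f t -> cont01 g t -> cont01 (fun s => f s + g s) t.
Proof.
move=> cf cg eps eps0; have e2 : 0 < eps / 2 by lra.
have [d1 d10 H1] := cf _ e2; have [d2 d20 H2] := cg _ e2.
exists (Num.min d1 d2) => [|s s01]; first by rewrite lt_min d10.
rewrite lt_min => /andP[/(H1 s s01) ? /(H2 s s01) ?].
have -> : f s + g s - (f t + g t) = (f s - f t) + (g s - g t) by ring.
by apply: le_lt_trans (ler_normD _ _) _; lra.
Qed.

Lemma cont01M f g t : cont01 f t -> cont01 g t -> cont01 (fun s => f s * g s) t.
Proof.
move=> cf cg eps eps0; pose M := `|f t| + `|g t| + 1.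
have M1 : 1 <= M by rewrite lerDr addr_ge0.
have M0 : 0 < M by lra.
have e2 : 0 < Num.min 1 (eps / (2 * M)) by rewrite lt_min ltr01 divr_gt0 // mulr_gt0.
have [d1 d10 H1] := cf _ e2; have [d2 d20 H2] := cg _ e2.
exists (Num.min d1 d2) => [|s s01]; first by rewrite lt_min d10.
rewrite lt_min => /andP[/(H1 s s01) Hf /(H2 s s01) Hg].
move: Hf Hg; rewrite !lt_min => /andP[f1 fe] /andP[_ ge].
have -> : f s * g s - f t * g t = f s * (g s - g t) + (f s - f t) * g t by ring.
apply: le_lt_trans (ler_normD _ _) _; rewrite !normrM.
have fs : `|f s| <= M.
  have : `|f s| <= `|f s - f t| + `|f t|.
    by rewrite -[X in `|X| <= _](subrK (f t)) ler_normD.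
  by rewrite /M; have := normr_ge0 (g t); lra.
have gt_ : `|g t| <= M by rewrite /M; have := normr_ge0 (f t); lra.
have E : eps = M * (eps / (2 * M)) + M * (eps / (2 * M)) by field; rewrite gt_eqF.
rewrite [ltRHS]E; apply: ltr_leD.
  apply: (@le_lt_trans _ _ (M * `|g s - g t|)); first by rewrite ler_wpM2r.
  by rewrite ltr_pM2l.
by rewrite mulrC ler_pM // ltW.
Qed.

Lemma cont01_sum (I : Type) (r : seq I) (P : pred I) (F : I -> R -> R) t :
  (forall i, cont01 (F i) t) -> cont01 (fun s => \sum_(i <- r | P i) F i s) t.
Proof.
move=> cF; elim: r => [|i r IH].
  by move=> eps eps0; exists 1 => // s _ _; rewrite !big_nil subrr normr0.
have [Pi|nPi] := boolP (P i); last first.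
  move=> eps /IH[delta d0 H]; exists delta => // s s01 st.
  by rewrite !big_cons (negbTE nPi) H.
move=> eps /(cont01D (cF i) IH)[delta d0 H]; exists delta => // s s01 st.
by rewrite !big_cons Pi H.
Qed.

Lemma cont01_prod (I : Type) (r : seq I) (P : pred I) (F : I -> R -> R) t :
  (forall i, cont01 (F i) t) -> cont01 (fun s => \prod_(i <- r | P i) F i s) t.
Proof.
move=> cF; elim: r => [|i r IH].
  by move=> eps eps0; exists 1 => // s _ _; rewrite !big_nil subrr normr0.
have [Pi|nPi] := boolP (P i); last first.
  move=> eps /IH[delta d0 H]; exists delta => // s s01 st.
  by rewrite !big_cons (negbTE nPi) H.
move=> eps /(cont01M (cF i) IH)[delta d0 H]; exists delta => // s s01 st.
by rewrite !big_cons Pi H.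
Qed.

Lemma cont01_det k (A : R -> 'M[R]_k) t :
  (forall i j, cont01 (fun s => A s i j) t) -> cont01 (fun s => \det (A s)) t.
Proof.
move=> cA; apply: cont01_sum => sigma; apply: cont01M; first exact: cont01_cst.
exact: cont01_prod.
Qed.
End UnitInterval.

(** * From spanning edge rows to rigidity along motions *)

Section InfinitesimalRigidity.
Variables (R : realType) (n d : nat).
Implicit Types (p q : 'I_n -> 'I_d -> R) (u v : 'I_n).
Local Notation N := #|{: 'I_n * 'I_d}|.

(** Over the reals, [x B B^T = 0] forces the squared norm of [x B] to vanish. *)
Lemma gram_unit r m (B : 'M[R]_(r, m)) : (B *m B^T \in unitmx) = row_free B.
Proof.
rewrite -row_free_unit; apply/idP/idP => [|/row_free_inj Binj].
  by rewrite /row_free => /eqP E; rewrite eqn_leq rank_leq_row -[leqLHS]E mxrankM_maxl.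
apply/inj_row_free => x xBB; apply: Binj; rewrite mul0mx.
have : (x *m B) *m (x *m B)^T = 0 by rewrite trmx_mul mulmxA -(mulmxA x) xBB mul0mx.
move/matrixP/(_ 0 0); rewrite !mxE => /eqP.
rewrite psumr_eq0 => [/allP H|j _]; last by rewrite [X in _ * X]mxE sqr_ge0.
apply/rowP => j; rewrite [RHS]mxE; apply/eqP.
by have := H j (mem_index_enum _); rewrite [X in _ * X]mxE mulf_eq0 orbb.
Qed.

Lemma sum_coords (f : 'I_n -> 'I_d -> R) :
  \sum_(j < N) f (enum_val j).1 (enum_val j).2 = \sum_u \sum_i f u i.
Proof.
rewrite pair_bigA /= (reindex_onto (fun j : 'I_N => enum_val j) enum_rank) /=.
  by apply: eq_big => [j|//]; rewrite enum_valK eqxx.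
by move=> ui _; rewrite enum_rankK.
Qed.

Lemma rho_dot p u v (x : 'I_n -> 'I_d -> R) :
  (rho p (u, v) *m (\row_j coords x j)^T) 0 0
  = \sum_i (p u i - p v i) * (x u i - x v i).
Proof.
rewrite mxE; under eq_bigr do rewrite !mxE /=.
rewrite (sum_coords (fun w i => ((w == u)%:R - (w == v)%:R) * (p u i - p v i) * x w i)).
rewrite exchange_big /=; apply: eq_bigr => i _.
have delta a (g : 'I_n -> R) : \sum_w (w == a)%:R * g w = g a.
  rewrite (bigD1 a) //= eqxx mul1r big1 ?addr0 // => w /negbTE->.
  by rewrite mul0r.
transitivity (\sum_w (w == u)%:R * ((p u i - p v i) * x w i)
    - \sum_w (w == v)%:R * ((p u i - p v i) * x w i)).
  by rewrite -sumrB; apply: eq_bigr => w _; ring.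
by rewrite !delta; ring.
Qed.

Lemma polarization p u v a b :
  \sum_i (p u i - p v i) * (p a i - p b i) = (sqdist (p u) (p b) + sqdist (p v) (p a)
    - sqdist (p u) (p a) - sqdist (p v) (p b)) / 2.
Proof.
by rewrite /sqdist -big_split -!sumrB /= mulr_suml; apply: eq_bigr => i _; field.
Qed.

(** Inner products of rows depend only on squared distances, so Gram determinants are invariant
    under congruence. *)
Lemma rho_rho p u v a b : (rho p (u, v) *m (rho p (a, b))^T) 0 0
  = \sum_w ((w == u)%:R - (w == v)%:R) * ((w == a)%:R - (w == b)%:R)
    * ((sqdist (p u) (p b) + sqdist (p v) (p a)
    - sqdist (p u) (p a) - sqdist (p v) (p b)) / 2).
Proof.
rewrite mxE; under eq_bigr do rewrite !mxE /=.
rewrite (sum_coords (fun w i => ((w == u)%:R - (w == v)%:R) * (p u i - p v i)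
  * (((w == a)%:R - (w == b)%:R) * (p a i - p b i)))).
apply: eq_bigr => w _; rewrite -polarization mulr_sumr; apply: eq_bigr => i _; ring.
Qed.

(* Two frameworks with the same edge lengths differ by an infinitesimal motion of
   their midpoint. *)
Lemma midpoint_motion p q u v :
  (rho (fun w i => (p w i + q w i) / 2) (u, v)
     *m (\row_j coords (fun w i => p w i - q w i) j)^T) 0 0
  = (sqdist (p u) (p v) - sqdist (q u) (q v)) / 2.
Proof.
by rewrite rho_dot /sqdist -sumrB mulr_suml; apply: eq_bigr => i _; field.
Qed.

Variables (e : rel 'I_n) (p : 'I_n -> 'I_d -> R).
Hypothesis gp : generic p.
Hypothesis rows_p : forall u v, (rho p (u, v) <= Rig p (edges e))%MS.

Definition row_basis : 'I_(\rank (Rig p (edges e))) -> 'I_#|{: 'I_n * 'I_n}| :=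
  maxrankfun (Rig p (edges e)).

(** The rows are selected once, as a basis at [p]. They stay independent at [q] exactly when this
    determinant is nonzero, a condition that is open along motions. *)
Definition basis_gram q : 'M[R]_(\rank (Rig p (edges e))) :=
  rowsub row_basis (Rig q (edges e)) *m (rowsub row_basis (Rig q (edges e)))^T.

Lemma basis_gramE q i j : basis_gram q i j =
  (row (row_basis i) (Rig q (edges e)) *m (row (row_basis j) (Rig q (edges e)))^T) 0 0.
Proof. by rewrite !mxE; apply: eq_bigr => k _; rewrite !mxE. Qed.

Lemma basis_gram_congr q q' :
  (forall u v, sqdist (q u) (q v) = sqdist (q' u) (q' v)) ->
  basis_gram q = basis_gram q'.
Proof.
move=> qq'; apply/matrixP => i j; rewrite !basis_gramE !rowK.
case: ifP => _; last by rewrite !mul0mx.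
case: ifP => _; last by rewrite !trmx0 !mulmx0.
case: (enum_val _) => u v; case: (enum_val _) => a b.
by rewrite !rho_rho; apply: eq_bigr => w _; rewrite !qq'.
Qed.

Lemma basis_gram_generic : \det (basis_gram p) != 0.
Proof. by rewrite -unitfE -unitmxE gram_unit maxrowsub_free. Qed.

(** The rank of all pairs at [q] is at most that at the generic [p], which is the number of selected
    rows; these are independent at [q], hence span. *)
Lemma rows_of_gram q u v : \det (basis_gram q) != 0 ->
  (rho q (u, v) <= Rig q (edges e))%MS.
Proof.
rewrite -unitfE -unitmxE gram_unit => Bfree.
have sub : (Rig q (edges e) <= Rig q setT)%MS by apply/RigS/subsetP => ? _; rewrite inE.
suff : (Rig q setT <= Rig q (edges e))%MS.
  by apply: submx_trans; apply: rho_sub; rewrite inE.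
rewrite -(geq_leqif (mxrank_leqif_sup sub)).
apply: leq_trans (generic_rank_Rig q setT gp) _.
apply: (@leq_trans (\rank (Rig p (edges e)))).
  by apply/mxrankS/Rig_subP => -[a b] _; exact: rows_p.
by rewrite -[leqLHS](eqP Bfree) mxrankS // rowsub_sub.
Qed.

(** The times at which all pairwise distances agree with those of [p] form an open and closed subset
    of the unit interval. Openness comes from the midpoint of [x s] and [x t], closedness from
    continuity of distances. *)
Lemma rigid_of_rows : rigid_framework e p.
Proof.
move=> x [x0 xc xe].
apply: unit_interval_connected => [|t t01 Pt|t t01 Pt u v].
- by rewrite x0.
- pose mid s := fun w i => (x s w i + x t w i) / 2.
  have cmid : cont01 (fun s => \det (basis_gram (mid s))) t.
    have cx w i : cont01 (fun s => mid s w i) t.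
      apply: cont01M (cont01_cst _ _); apply: cont01D (cont01_cst _ _).
      move=> eps /(xc t t01)[delta d0 H]; exists delta => // s s01 st; exact: H.
    apply: cont01_det => i j.
    have E s : basis_gram (mid s) i j
        = \sum_k Rig (mid s) (edges e) (row_basis i) k * Rig (mid s) (edges e) (row_basis j) k.
      by rewrite basis_gramE mxE; apply: eq_bigr => k _; rewrite !mxE.
    have cR a b : cont01 (fun s => Rig (mid s) (edges e) a b) t.
      have RE s : Rig (mid s) (edges e) a b = (enum_val a \in edges e)%:R *
         ((((enum_val b).1 == (enum_val a).1)%:R - ((enum_val b).1 == (enum_val a).2)%:R)
         * (mid s (enum_val a).1 (enum_val b).2 + -1 * mid s (enum_val a).2 (enum_val b).2)).
        rewrite mxE; case: ifP => _; rewrite mxE ?mul0r // mul1r.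
        by rewrite mulN1r.
      move=> eps eps0.
      have [delta d0 H] := cont01M (cont01_cst (enum_val a \in edges e)%:R t)
        (cont01M (cont01_cst (((enum_val b).1 == (enum_val a).1)%:R - ((enum_val b).1 == (enum_val a).2)%:R) t)
          (cont01D (cx (enum_val a).1 (enum_val b).2)
             (cont01M (cont01_cst (-1) t) (cx (enum_val a).2 (enum_val b).2)))) eps0.
      by exists delta => // s s01 st; rewrite !RE; exact: H.
    move=> eps eps0.
    have [delta d0 H] := cont01_sum (index_enum _) predT
      (fun k => cont01M (cR (row_basis i) k) (cR (row_basis j) k)) eps0.
    by exists delta => // s s01 st; rewrite !E; exact: H.
  (* [mid t] is [x t], which is congruent to [p]. *)
  have D0 : \det (basis_gram (mid t)) != 0.
    rewrite (@basis_gram_congr _ p) ?basis_gram_generic // => u v; rewrite -Pt.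
    by rewrite /sqdist /mid; apply: eq_bigr => i _; field.
  have [|delta d0 H] := cmid `|\det (basis_gram (mid t))|; first by rewrite normr_gt0.
  exists delta => // s s01 st u v; rewrite -Pt.
  have Ds : \det (basis_gram (mid s)) != 0.
    apply: contraTneq (H s s01 st) => ->; rewrite sub0r normrN ltxx //.
  have := rows_of_gram u v Ds => /submxP[c cE].
  (* The row of [uv] is a combination of edge rows, and these annihilate [x s - x t] because edge
     lengths agree at both times. *)
  have : (rho (mid s) (u, v) *m (\row_j coords (fun w i => x s w i - x t w i) j)^T) 0 0 = 0.
    rewrite cE -mulmxA (_ : Rig _ _ *m _ = 0) ?mulmx0 ?mxE //.
    apply/colP => k; rewrite mxE [RHS]mxE.
    transitivity ((row k (Rig (mid s) (edges e)) *m (\row_j coords (fun w i => x s w i - x t w i) j)^T) 0 0).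
      by rewrite mxE; apply: eq_bigr => j _; rewrite !mxE.
    rewrite rowK; case: ifP => [|_]; last by rewrite mul0mx mxE.
    case: (enum_val k) => a b; rewrite inE /= => eab.
    by rewrite midpoint_motion !xe // subrr mul0r.
  rewrite midpoint_motion => /eqP; rewrite mulf_eq0 invr_eq0 pnatr_eq0 orbF subr_eq0.
  by move/eqP.
- apply/eqP; rewrite -subr_eq0 -normr_le0; apply/ler_addgt0Pl => eps eps0; rewrite addr0.
  have cs : cont01 (fun s => \sum_i (x s u i + -1 * x s v i) * (x s u i + -1 * x s v i)) t.
    have cx w i : cont01 (fun s => x s w i) t.
      move=> eps1 /(xc t t01)[delta d0 H]; exists delta => // s s01 st; exact: H.
    have ci i : cont01 (fun s => x s u i + -1 * x s v i) t.
      by apply: cont01D (cx _ _) _; apply: cont01M (cont01_cst _ _) (cx _ _).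
    by apply: cont01_sum => i; apply: cont01M; exact: ci.
  have sE s : sqdist (x s u) (x s v) = \sum_i (x s u i + -1 * x s v i) * (x s u i + -1 * x s v i).
    by apply: eq_bigr => i _; ring.
  have [delta d0 H] := cs _ eps0.
  have [s [s01 st Ps]] := Pt _ d0.
  by rewrite distrC -(Ps u v) !sE ltW // H.
Qed.
End InfinitesimalRigidity.

Lemma generic_exists (R : realType) n d : exists p : 'I_n -> 'I_d -> R, generic p.
Proof.
have [x xP] := @alg_indep_point R #|{: 'I_n * 'I_d}|.
exists (fun v i => x (enum_rank (v, i))) => P P0; apply: xP; rewrite -[RHS]P0.
by apply: meval_eq => k /=; rewrite -surjective_pairing enum_valK.
Qed.

Lemma cont01V (R : realType) (f : R -> R) t : f t != 0 -> cont01 f t ->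
  cont01 (fun s => (f s)^-1) t.
Proof.
move=> ft0 cf eps eps0; pose m := `|f t|.
have m0 : 0 < m by rewrite normr_gt0.
have h0 : 0 < Num.min (m / 2) (eps * m ^+ 2 / 2).
  by rewrite lt_min !divr_gt0 // mulr_gt0 // exprn_gt0.
have [delta d0 H] := cf _ h0; exists delta => // s s01 /(H s s01).
rewrite lt_min => /andP[H1 H2].
have fs : m / 2 < `|f s|.
  have : m <= `|f s - f t| + `|f s|.
    by rewrite /m distrC -[X in `|X| <= _](subrK (f s)) ler_normD.
  lra.
have fs0 : f s != 0 by rewrite -normr_gt0; lra.
have -> : (f s)^-1 - (f t)^-1 = (f t - f s) / (f s * f t).
  by field; rewrite fs0 ft0.
rewrite normrM distrC normfV normrM ltr_pdivrMr; last by rewrite mulr_gt0 // normr_gt0.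
apply: lt_trans H2 _; rewrite -/m -mulrA ltr_pM2l // expr2 mulrAC.
by rewrite ltr_pM2r.
Qed.

Lemma cont01_uniform (R : realType) (I : finType) (F : I -> R -> R) t :
  (forall i, cont01 (F i) t) -> forall eps, 0 < eps -> exists2 delta, 0 < delta &
    forall s, in01 s -> `|s - t| < delta -> forall i, `|F i s - F i t| < eps.
Proof.
move=> cF eps eps0.
suff [delta d0 H] : exists2 delta, 0 < delta & forall s, in01 s -> `|s - t| < delta ->
    forall i, i \in enum I -> `|F i s - F i t| < eps.
  by exists delta => // s s01 st i; apply: H; rewrite ?mem_enum.
elim: (enum I) => [|i r [d1 d10 H1]]; first by exists 1.
have [d2 d20 H2] := cF i eps eps0.
exists (Num.min d1 d2) => [|s s01]; first by rewrite lt_min d10.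
rewrite lt_min => /andP[s1 s2] j; rewrite inE => /orP[/eqP->|jr]; first exact: H2.
exact: H1.
Qed.

(** * Flexibility caused by a vertex of low degree *)

Section LowDegreeFlex.
Variables (R : realType) (n d : nat).
Implicit Types (p : 'I_n -> 'I_d -> R) (T : {set 'I_n}).

(** The [d] generic directions from [u] to [T] are independent, so their inner products with a
    vector can be prescribed. *)
Lemma dual_vector p u T (f : 'I_n -> R) : generic p -> u \notin T -> #|T| = d ->
  exists a : 'I_d -> R, forall t, t \in T -> \sum_i a i * (p u i - p t i) = f t.
Proof.
move=> gp uT cT.
pose M := \matrix_(k < #|T|) (\row_i (p u i - p (enum_val k) i)).
have Mfree : row_free M.
  have Td : (#|T| <= d)%N by rewrite cT.
  rewrite /row_free eqn_leq rank_leq_row /=.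
  apply: (@leq_trans (\rank (dirs p u T))); first by rewrite generic_dirs.
  apply/mxrankS/dirs_subP => t tT.
  have -> : \row_i (p u i - p t i) = row (enum_rank_in tT t) M.
    by rewrite rowK enum_rankK_in.
  exact: row_sub.
pose a := pinvmx M *m \col_k f (enum_val k).
exists (fun i => a i 0) => t tT.
have : (M *m a) (enum_rank_in tT t) 0 = f t.
  by rewrite mulmxA mulmxVp // mul1mx mxE enum_rankK_in.
rewrite mxE => <-; apply: eq_bigr => i _.
by rewrite !mxE enum_rankK_in // mulrC.
Qed.

Lemma sqdist_shift (a b y : 'I_d -> R) :
  sqdist (fun i => a i + y i) b
  = sqdist a b + (\sum_i y i ^+ 2 + 2 * \sum_i y i * (a i - b i)).
Proof.
by rewrite /sqdist mulr_sumr -!big_split /=; apply: eq_bigr => i _; ring.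
Qed.

(* A vertex with fewer than [d] neighbours moves along the circle of points having the
   right distances to [d - 1] vertices, parametrised rationally by inversion. *)
Lemma low_degree_flexible (e : rel 'I_n) p u v (S : {set 'I_n}) :
  generic p -> simple_graph e -> (forall w, e u w -> w \in S) ->
  u \notin S -> v \notin S -> u != v -> #|S|.+1 = d -> ~ rigid_framework e p.
Proof.
move=> gp [es ei] eS uS vS uv cS rig.
pose T := v |: S.
have uT : u \notin T by rewrite in_setU1 negb_or uv.
have cT : #|T| = d by rewrite cardsU1 vS.
have vT : v \in T by exact: setU11.
(* On the line [t a + b] the product with the direction from a vertex of [S] is [t], and with the
   one from [v] it is [t + 1]; the latter keeps [w t] nonzero. *)
have [a aP] := dual_vector (fun=> 1) gp uT cT.
have [b bP] := dual_vector (fun t => (t == v)%:R) gp uT cT.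
pose w t i := t * a i + b i; pose Q t := \sum_i w t i ^+ 2.
have wdot t s : s \in T -> \sum_i w t i * (p u i - p s i) = t + (s == v)%:R.
  move=> sT; rewrite -(bP s sT) -[X in X + _]mulr1 -[X in _ * X + _](aP s sT).
  by rewrite mulr_sumr -big_split; apply: eq_bigr => i _; rewrite /w /=; ring.
have Q0 t : in01 t -> Q t != 0.
  move=> /andP[t0 _]; apply/eqP => Qt.
  have wt i : w t i = 0.
    move/eqP: Qt; rewrite /Q psumr_eq0 => [/allP H|j _]; last exact: sqr_ge0.
    by have := H i (mem_index_enum _); rewrite sqrf_eq0 => /eqP.
  have := wdot t v vT; rewrite eqxx big1 => [/= t1|i _]; last by rewrite wt mul0r.
  by have := ltr_pwDr ltr01 t0; rewrite -t1 ltxx.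
(* With this factor the squared distance from [u] to a vertex of [S] changes by [c^2 Q + 2 c t = 0],
   and that to [v] by [2 c], which is nonzero at [t = 1]. At [t = 0] there is no displacement. *)
pose c t := -2 * t * (Q t)^-1; pose y t i := c t * w t i.
pose x t z := if z == u then fun i => p u i + y t i else p z.
have ysq t s : in01 t -> s \in T -> \sum_i y t i ^+ 2 + 2 * \sum_i y t i * (p u i - p s i)
    = 2 * c t * (s == v)%:R.
  move=> t01 sT.
  have -> : \sum_i y t i ^+ 2 = c t ^+ 2 * Q t.
    by rewrite mulr_sumr; apply: eq_bigr => i _; rewrite /y; ring.
  have -> : \sum_i y t i * (p u i - p s i) = c t * (t + (s == v)%:R).
    by rewrite -wdot // mulr_sumr; apply: eq_bigr => i _; rewrite /y; ring.
  have -> : c t ^+ 2 * Q t = c t * (-2 * t) by rewrite expr2 -mulrA /c mulfVK ?Q0.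
  ring.
have xu t : x t u = fun i => p u i + y t i by rewrite /x eqxx.
have xz t z : z != u -> x t z = p z by rewrite /x => /negbTE->.
have mx : continuous_motion e p x.
  split=> [|t t01 eps eps0|t t01].
  - apply: boolp.funext => z; rewrite /x; case: eqVneq => // ->.
    by apply: boolp.funext => i; rewrite /y /c !mulr0 !mul0r addr0.
  - have cy i : cont01 (fun s => y s i) t.
      have cw j : cont01 (fun s => w s j) t.
        by apply: cont01D (cont01_cst _ _); apply: cont01M (cont01_cst _ _) => eps1 ?; exists eps1.
      apply: cont01M (cw i); apply: cont01M.
        by apply: cont01M (cont01_cst _ _) _ => eps1 ?; exists eps1.
      apply: cont01V (Q0 t t01) _; apply: cont01_sum => j.
      exact: cont01M.
    have [delta d0 H] := cont01_uniform cy eps0; exists delta => // s s01 st z i.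
    have [->|zu] := eqVneq z u; last by rewrite !xz // subrr normr0.
    rewrite !xu (_ : _ - _ = y s i - y t i); last by ring.
    exact: H.
  - have main s : s \in S -> sqdist (x t u) (x t s) = sqdist (p u) (p s).
      move=> sS; have su : s != u by apply: contraNneq uS => <-.
      rewrite xu xz // sqdist_shift ysq // ?in_setU1 ?sS ?orbT //.
      by rewrite [s == v]negbTE ?mulr0 ?addr0 //; apply: contraNneq vS => <-.
    have sqC (g h : 'I_d -> R) : sqdist g h = sqdist h g.
      by apply: eq_bigr => i _; rewrite -sqrrN opprB.
    move=> z z' ezz'; have [zu|zu] := eqVneq z u; last first.
      have [z'u|z'u] := eqVneq z' u; last by rewrite !xz.
      by rewrite sqC z'u [RHS]sqC main // eS // es -z'u.
    by rewrite zu main // eS // -zu.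
have i1 : in01 (1 : R) by rewrite /in01 ler01 lexx.
have := rig x mx 1 i1 u v; rewrite xu xz 1?eq_sym // sqdist_shift ysq // eqxx mulr1.
move=> /eqP; rewrite -subr_eq0 addrC addKr !mulf_eq0 invr_eq0 (negbTE (Q0 1 i1)) orbF.
by rewrite oppr_eq0 pnatr_eq0 oner_eq0.
Qed.
End LowDegreeFlex.

(** * The two bounds on [g] *)

Lemma g_bound_upper (R : realType) n d : (0 < d)%N -> (d * (d + 2) <= n)%N ->
  g_bound R n d (n%:Z + d%:Z - 2).
Proof.
move=> d0 dn e es eta; have [p gp] := generic_exists R n d; exists p; split=> //.
apply: rigid_of_rows => //; exact: generic_rigid_rows.
Qed.

Lemma g_bound_lower (R : realType) n d (k : int) : (0 < d)%N -> (d < n)%N ->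
  g_bound R n d k -> n%:Z + d%:Z - 2 <= k.
Proof.
move=> d0 dn gk; rewrite leNgt; apply/negP => kn.
case: n dn gk kn => // n; rewrite ltnS => dn gk kn.
pose u : 'I_n.+1 := ord0.
have cu : #|~: [set u]| = n by rewrite cardsCs setCK cards1 card_ord subn1.
have [|T Tu cT] := @subset_of_card _ (~: [set u]) d; first by rewrite cu.
have /card_gt0P[v vT] : (0 < #|T|)%N by rewrite cT.
pose S := T :\ v.
have cS : #|S|.+1 = d by rewrite -cT (cardsD1 v T) vT.
have uT : u \notin T by apply/negP => /(subsetP Tu); rewrite !inE eqxx.
have uS : u \notin S by rewrite !inE negb_and (negbTE uT) orbT.
have vS : v \notin S by rewrite !inE eqxx.
have uv : u != v by apply: contraNneq uT => ->.
(* A clique on all vertices but [u], with [u] joined exactly to the [d - 1] vertices of [S]. *)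
pose e : rel 'I_n.+1 := fun x y =>
  (x != y) && [|| (x != u) && (y != u), x \in S | y \in S].
have es : simple_graph e.
  split=> [x y|x]; last by rewrite /e eqxx.
  by rewrite /e eq_sym [(y != u) && _]andbC [(x \in S) || _]orbC.
have euS w : e u w -> w \in S by rewrite /e eqxx (negbTE uS) => /andP[].
have [|p [gp rig]] := gk e es; last first.
  exact: (low_degree_flexible gp es euS uS vS uv cS rig).
have degS : (#|S| <= deg e u)%N.
  apply/subset_leq_card/subsetP => w wS; rewrite inE /e wS !orbT andbT.
  by apply: contraNneq uS => ->.
have deg_other y : y != u -> (n.-1 <= deg e y)%N.
  move=> yu; have <- : #|~: [set u; y]| = n.-1.
    by rewrite cardsCs setCK cards2 eq_sym yu card_ord subn2.
  apply/subset_leq_card/subsetP => w; rewrite !inE negb_or => /andP[wu wy].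
  by rewrite /e eq_sym wy yu wu.
(* A nonadjacent pair contains [u], so its degree sum is at least [(d - 1) + (n - 1)], one less than
   the claimed value for [n + 1] vertices. *)
move=> x y xy; rewrite /e xy !negb_or negb_and !negbK => /and3P[/orP[/eqP xu|/eqP yu] _ _].
  have yu : y != u by rewrite eq_sym -xu.
  have := deg_other y yu; rewrite -/e xu; clearbody e; lia.
have xu : x != u by rewrite -yu.
have := deg_other x xu; rewrite -/e yu; clearbody e; lia.
Qed.

Theorem theorem1p4 (R : realType) (n d : nat) :
  (0 < n)%N -> (0 < d)%N -> (d * (d + 2) <= n)%N ->
  g_is R n d (n%:Z + d%:Z - 2).
Proof.
move=> _ d0 dn; split; first exact: g_bound_upper.
by move=> k; apply: g_bound_lower => //; nia.
Qed.
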